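(* Fix constants $\beta>0$ and $\gamma>0$, and for each $n$ let $\mathcal{G}^{(n)}:=\mathcal{G}^{(n)}_{\lfloor\beta n\rfloor,\gamma/n}$ be the random intersection graph on $n$ vertices with $m=\lfloor \beta n\rfloor$ auxiliary vertices and $p=\gamma/n$. Let $\mu:=\beta\gamma^2$, and let $\rho$ be the smallest non-negative root of $\rho=g(\rho)$, where $g(s)=\exp\{\beta\gamma(e^{\gamma(s-1)}-1)\}$. (i) If $\mu<1$, then there is a constant $K=K(\beta,\gamma)$ such that, with probability tending to $1$ as $n\to\infty$, every connected component of $\mathcal{G}^{(n)}$ has at most $K\log n$ vertices. (ii) If $\mu>1$, then $0<\rho<1$; with probability tending to $1$ there is a unique connected component (the giant component) whose number of vertices $L_1^{(n)}$ satisfies $L_1^{(n)}/n\to 1-\rho$ in probability; and there is a constant $K=K(\beta,\gamma)$ such that, with probability tending to $1$, every other connected component has at most $K\log n$ vertices.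
   Context: The random intersection graph $\mathcal{G}^{(n)}_{m,p}$ has vertex set $\mathcal{V}=\{v_1,\dots,v_n\}$. It is built from a random bipartite graph on $\mathcal{V}$ and a set $\mathcal{A}=\{a_1,\dots,a_m\}$ of auxiliary vertices, in which each of the $nm$ possible edges $v_ia_k$ is present independently with probability $p$. Two distinct vertices $v_i,v_j$ are adjacent in $\mathcal{G}^{(n)}_{m,p}$ if and only if some auxiliary vertex $a_k$ is adjacent to both in the bipartite graph. The function $g$ is the probability generating function of the compound Poisson distribution $\mathrm{CPoisson}(\beta\gamma,\gamma)$, i.e. the law of a sum of a $\mathrm{Poisson}(\beta\gamma)$ number of independent $\mathrm{Poisson}(\gamma)$ variables; $\mu$ is the mean of this distribution and is the limiting expected degree of a vertex of $\mathcal{G}^{(n)}$. *)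

(* Defs.v *)
From Stdlib Require Import Reals.
From mathcomp Require Import all_boot.
Set Implicit Arguments. Unset Strict Implicit. Unset Printing Implicit Defensive.

(* boolean version of <= on R, so that events are boolean predicates *)
Definition Rleb (x y : R) : bool := if Rle_dec x y then true else false.

(* A realisation of the random bipartite graph between V = 'I_n and A = 'I_m
   is the set B of present edges (v_i, a_k). *)
Definition bipartite (n m : nat) := {set 'I_n * 'I_m}.

Definition rig_adj (n m : nat) (B : bipartite n m) : rel 'I_n :=
  fun i j => (i != j) && [exists k : 'I_m, ((i, k) \in B) && ((j, k) \in B)].

Definition comp_size (n m : nat) (B : bipartite n m) (v : 'I_n) : nat :=
  #|[set w | connect (rig_adj B) v w]|.

Definition largest_comp (n m : nat) (B : bipartite n m) : nat :=
  \max_(v : 'I_n) comp_size B v.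

(* probability of B when each of the n*m edges is present independently w.p. p *)
Definition bip_weight (n m : nat) (p : R) (B : bipartite n m) : R :=
  Rmult (pow p #|B|) (pow (Rminus 1 p) (n * m - #|B|)).

Definition prob (n m : nat) (p : R) (E : pred (bipartite n m)) : R :=
  \big[Rplus/R0]_(B : bipartite n m | E B) bip_weight p B.

Definition m_of (beta : R) (n : nat) : nat := Z.to_nat (Int_part (Rmult beta (INR n))).
Definition p_of (gamma : R) (n : nat) : R := Rdiv gamma (INR n).

Definition rig_prob (beta gamma : R) (n : nat)
    (E : pred (bipartite n (m_of beta n))) : R :=
  prob (p_of gamma n) E.

(* pgf of CPoisson(beta gamma, gamma) *)
Definition g (beta gamma s : R) : R :=
  exp (Rmult (Rmult beta gamma) (Rminus (exp (Rmult gamma (Rminus s 1))) 1)).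

Definition smallest_fixpoint (beta gamma rho : R) : Prop :=
  Rle 0 rho /\ rho = g beta gamma rho /\
  (forall s, Rle 0 s -> s = g beta gamma s -> Rle rho s).

Arguments rig_prob beta gamma n E : clear implicits.

(* Main.v *)
Require Import Defs.

From Stdlib Require Import Reals ZArith Lia Lra.
From mathcomp Require Import all_boot all_order all_algebra.
From mathcomp Require Import zify Rstruct.
From mathcomp Require ring lra.
(* [Rstruct] also defines a [Rleb]: the one of [Defs] has to shadow it. *)
Import Defs.
Set Implicit Arguments. Unset Strict Implicit. Unset Printing Implicit Defensive.
Import Order.TTheory GRing.Theory Num.Theory.

(** Write q = 1 - p, and let U be a set of vertices. Exploring the bipartite graph from U one
    vertex at a time shows that the probability that exactly k vertices and l auxiliary vertices
    are reached is at most P(Bin(m, 1 - q^k) = l) P(Bin(n - |U|, 1 - q^l) = k - |U|). By Chernoff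
    bounds this is exponentially small in k unless k/n is close to a fixed point of
    h(x) = 1 - g(1 - x), which satisfies h(x) <= mu x and for which h(x)/x is decreasing.

    If mu < 1, h stays away from the diagonal, whence (i). If mu > 1, the only positive fixed
    point of h is 1 - rho. Hence, with high probability, the union of any two components, and the
    union of the components meeting a fixed seed set of about K log n vertices, has either fewer
    than K log n vertices or about (1 - rho) n. The seed falls in the second case, so it meets a
    component with more than K log n vertices, that is one with about (1 - rho) n. There is no
    other component with more than K log n vertices, since the union of two such components
    would have about 2 (1 - rho) n vertices. *)

(** * Random subsets and percolation clusters *)

Section RandomSet.
Import ring lra.
Local Open Scope ring_scope.
Variables (R : realFieldType) (E : finType) (p : R).
Hypotheses (p_ge0 : 0 <= p) (p_le1 : p <= 1).
Implicit Types (B D : {set E}).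

Definition weight B : R := \prod_e (if e \in B then p else 1 - p).
Definition expect (F : {set E} -> R) : R := \sum_B weight B * F B.

Lemma weight_ge0 B : 0 <= weight B.
Proof. by apply: prodr_ge0 => e _; case: ifP => _; move: p_ge0 p_le1; lra. Qed.

(** Independence of the coordinates: expanding the product of two-term sums yields one term per
    subset. *)
Lemma expect_prod (F : E -> bool -> R) :
  expect (fun B => \prod_e F e (e \in B)) =
  \prod_e (p * F e true + (1 - p) * F e false).
Proof.
rewrite bigA_distr /expect; apply: eq_bigr => B _.
by rewrite -big_split; apply: eq_bigr => e _ /=; case: (e \in B).
Qed.

Lemma expect_mem e (phi : bool -> R) :
  expect (fun B => phi (e \in B)) = p * phi true + (1 - p) * phi false.
Proof.
have := expect_prod (fun e' b => if e' == e then phi b else 1).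
rewrite (bigD1 e) //= eqxx big1 ?mulr1 => [<-|e' /negbTE ->]; last by ring.
apply: eq_bigr => B _; rewrite (bigD1 e) //= eqxx big1 ?mulr1 //.
by move=> e' /negbTE ->.
Qed.

Lemma weight_sum1 : \sum_B weight B = 1.
Proof.
have := expect_prod (fun _ _ => 1); rewrite [RHS]big1 => [<-|e _]; last by ring.
by apply: eq_bigr => B _; rewrite big1 ?mulr1.
Qed.

Lemma expect_cst a : expect (fun=> a) = a.
Proof. by rewrite /expect -mulr_suml weight_sum1 mul1r. Qed.

Lemma eq_expect F G : F =1 G -> expect F = expect G.
Proof. by move=> FG; apply: eq_bigr => B _; rewrite FG. Qed.

Lemma ler_expect F G : (forall B, F B <= G B) -> expect F <= expect G.
Proof. by move=> FG; apply: ler_sum => B _; apply: ler_wpM2l => //; apply: weight_ge0. Qed.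

(* Swapping the restrictions to D of two independent copies is a
   weight-preserving involution on pairs. *)
Lemma expect_decouple D (F : {set E} -> {set E} -> R) :
    (forall B1 B1' B2 B2', B1 :&: D = B1' :&: D -> B2 :\: D = B2' :\: D ->
       F B1 B2 = F B1' B2') ->
  expect (fun B => F B B) = expect (fun B1 => expect (fun B2 => F B1 B2)).
Proof.
move=> Fdep.
pose mix B1 B2 := (B1 :&: D) :|: (B2 :\: D).
have mixE B1 B2 e : (e \in mix B1 B2) = if e \in D then e \in B1 else e \in B2.
  by rewrite !inE; case: (e \in D); rewrite ?andbT ?andbF ?orbF.
pose f (z : {set E} * {set E}) := (mix z.1 z.2, mix z.2 z.1).
have fK : involutive f.
  by case=> B1 B2; rewrite /f /=; congr (_, _); apply/setP=> e; rewrite !mixE; case: (e \in D).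
under [RHS]eq_bigr => B1 _ do rewrite mulr_sumr.
rewrite pair_bigA /= (reindex_inj (inv_inj fK)) /=.
transitivity (\sum_(z : {set E} * {set E}) weight z.1 * (weight z.2 * F z.1 z.1)).
  rewrite -(pair_bigA _ (fun B1 B2 => weight B1 * (weight B2 * F B1 B1))) /=.
  by apply: eq_bigr => B1 _; rewrite -mulr_sumr -mulr_suml weight_sum1 mul1r.
apply: eq_bigr => -[B1 B2] _ /=; rewrite !mulrA; congr (_ * _).
  rewrite -!big_split; apply: eq_bigr => e _ /=; rewrite !mixE.
  by case: (e \in D) => //; rewrite mulrC.
by apply: Fdep; apply/setP=> e; rewrite !inE; case: (e \in D); rewrite ?andbT ?andbF ?orbF.
Qed.

End RandomSet.

(** * Bond percolation: exploration of a cluster and a bound on its law *)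

Section Percolation.
Import ring lra.
Local Open Scope ring_scope.
Variables (R : realFieldType) (X E : finType) (p : R) (ed : X -> X -> option E).
Hypotheses (p_ge0 : 0 <= p) (p_le1 : p <= 1).
(** A label determines its unordered pair of endpoints, so the edges at a vertex and the edges
    avoiding it carry disjoint sets of labels. *)
Hypothesis ed_inj : forall e x y u z, ed x y = Some e -> ed u z = Some e ->
  (u = x /\ z = y) \/ (u = y /\ z = x).
Implicit Types (A U Y : {set X}) (B : {set E}).

Definition adj B : rel X := fun x y => if ed x y is Some e then e \in B else false.

(** [A] is the set of vertices still available; it constrains every vertex of a path except its
    source. *)
Definition cluster B A U : {set X} :=
  [set y | [exists x in U, connect [rel x y | adj B x y && (y \in A)] x y]].

Lemma cluster_min B A U (P : pred X) :
    {subset U <= P} -> (forall x y, P x -> adj B x y -> y \in A -> P y) ->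
  {subset cluster B A U <= P}.
Proof.
move=> UP clP y; rewrite inE => /exists_inP[x xU /connectP[s sp ->]].
have := UP x xU; rewrite /in_mem /=.
elim: s x {xU} sp => //= z s IH x /andP[/andP[axz zA] sp] Px.
by apply: IH sp _; apply: clP Px axz zA.
Qed.

Lemma sub_cluster B A U : U \subset cluster B A U.
Proof. by apply/subsetP => x xU; rewrite inE; apply/exists_inP; exists x. Qed.

Lemma cluster_step B A U x y :
  x \in cluster B A U -> adj B x y -> y \in A -> y \in cluster B A U.
Proof.
rewrite !inE => /exists_inP[z zU czx] axy yA; apply/exists_inP; exists z => //.
by apply: connect_trans czx (connect1 _); rewrite /= axy.
Qed.

Lemma cluster_sub B A U : U \subset A -> cluster B A U \subset A.
Proof.
by move=> /subsetP UA; apply/subsetP; apply: (@cluster_min _ _ _ (mem A)) => // x y _ _.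
Qed.

Definition nbhd B A u := [set y in A | adj B u y].

(** A path that passes through [u] can be restarted at the next vertex, a neighbour of [u]; hence
    [u] can be deleted once its neighbours have become sources. *)
Lemma cluster_explore B A U u : u \in U -> U \subset A ->
  cluster B A U = u |: cluster B (A :\ u) ((U :|: nbhd B A u) :\ u).
Proof.
move=> uU /subsetP UA; apply/eqP; rewrite eqEsubset; apply/andP; split; apply/subsetP.
- apply: (@cluster_min _ _ _ (mem (u |: cluster B (A :\ u) ((U :|: nbhd B A u) :\ u)))).
    move=> x xU; rewrite /= in_setU1; have [//|xu] := eqVneq x u.
    by apply/orP; right; apply: (subsetP (sub_cluster _ _ _)); rewrite !inE xu xU.
  move=> x y /= xC axy yA; rewrite in_setU1.
  have [//|yu] := eqVneq y u; rewrite orFb.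
  move: xC; rewrite in_setU1 => /orP[/eqP xu|xC].
    by apply: (subsetP (sub_cluster _ _ _)); rewrite !inE yu yA -xu axy orbT.
  by apply: cluster_step xC axy _; rewrite !inE yu.
- move=> y; rewrite in_setU1 => /orP[/eqP ->|].
    exact: (subsetP (sub_cluster _ _ _)).
  move: y; apply: (@cluster_min _ _ _ (mem (cluster B A U))).
    move=> x; rewrite in_setD1 in_setU in_set => /andP[_ /orP[xU|/andP[xA aux]]].
      exact: (subsetP (sub_cluster _ _ _)).
    by apply: cluster_step aux xA; apply: (subsetP (sub_cluster _ _ _)).
  move=> x y /= xC axy; rewrite in_setD1 => /andP[_ yA]; exact: cluster_step axy yA.
Qed.

Lemma adj_local B B' x y :
  (forall e, ed x y = Some e -> (e \in B) = (e \in B')) -> adj B x y = adj B' x y.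
Proof. by rewrite /adj; case: (ed x y) => // e; apply. Qed.

Lemma cluster_local B B' A U : U \subset A ->
    (forall x y, x \in A -> y \in A -> adj B x y = adj B' x y) ->
  cluster B A U = cluster B' A U.
Proof.
suff sub C C' : U \subset A ->
    (forall x y, x \in A -> y \in A -> adj C x y = adj C' x y) ->
    cluster C A U \subset cluster C' A U.
  move=> UA BB'; apply/eqP; rewrite eqEsubset !sub //.
  by move=> x y xA yA; rewrite BB'.
move=> UA CC'; apply/subsetP.
apply: (@cluster_min _ _ _ (mem (cluster C' A U))) => [x|x y /= xC axy yA].
  exact: (subsetP (sub_cluster _ _ _)).
apply: (cluster_step xC _ yA); rewrite -CC' //.
exact: (subsetP (cluster_sub _ UA) x xC).
Qed.

(** Probability that [adj B x y] fails; a pair without label is never adjacent. *)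
Definition absent x y : R := if ed x y is Some _ then 1 - p else 1.

Lemma absent_ge0 x y : 0 <= absent x y.
Proof. by rewrite /absent; case: ed => *; move: p_ge0 p_le1; lra. Qed.

Lemma absent_le1 x y : absent x y <= 1.
Proof. by rewrite /absent; case: ed => *; move: p_ge0 p_le1; lra. Qed.

Lemma expect_adj x y (phi : bool -> R) :
  expect p (fun B => phi (adj B x y)) =
  (1 - absent x y) * phi true + absent x y * phi false.
Proof.
rewrite /absent /adj; case: (ed x y) => [e|]; last by rewrite expect_cst; ring.
by rewrite expect_mem; ring.
Qed.

(** Distinct [y] use distinct labels at [u], so the factors are independent; each is split off by
    decoupling the label of its edge. *)
Lemma expect_prod_adj u (phi : X -> bool -> R) :
  expect p (fun B => \prod_y phi y (adj B u y)) =
  \prod_y ((1 - absent u y) * phi y true + absent u y * phi y false).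
Proof.
elim: (index_enum X) (index_enum_uniq X) => [_|y s IH /= /andP[ys us]].
  by rewrite big_nil; under eq_expect => B do rewrite big_nil; rewrite expect_cst.
rewrite big_cons -IH //; under eq_expect => B do rewrite big_cons.
pose D := [set e | ed u y == Some e].
rewrite (@expect_decouple _ _ p D (fun B1 B2 =>
  phi y (adj B1 u y) * \prod_(z <- s) phi z (adj B2 u z))); last first.
  move=> B1 B1' B2 B2' /setP BD /setP BD'; congr (phi y _ * _).
    apply: adj_local => e ey; have := BD e.
    by rewrite !inE ey eqxx !andbT.
  rewrite big_seq [RHS]big_seq; apply: eq_bigr => z zs; congr (phi z _).
  apply: adj_local => e ez; have := BD' e; rewrite !inE; case: eqP => //= ey.
  have := ed_inj ez ey => -[[_ yz]|[uz yu]]; first by rewrite yz zs in ys.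
  by rewrite yu uz zs in ys.
rewrite -expect_adj [RHS]mulr_suml; apply: eq_bigr => B _.
rewrite -mulrA; congr (_ * _); rewrite [RHS]mulr_sumr.
by apply: eq_bigr => B' _; rewrite mulrCA.
Qed.

(** Each vertex of [Y] outside [U] must have a neighbour in [Y], and each vertex of [A] outside [Y]
    must have none; the probabilities are multiplied as if these events were independent. *)
Definition cluster_bound A U Y : R :=
  \prod_y (if y \in Y then if y \in U then 1 else 1 - \prod_(x in Y) absent x y
           else if y \in A then \prod_(x in Y) absent x y else 1).

Lemma prod_absent_ge0 Y y : 0 <= \prod_(x in Y) absent x y.
Proof. by apply: prodr_ge0 => x _; apply: absent_ge0. Qed.

Lemma prod_absent_le1 Y y : \prod_(x in Y) absent x y <= 1.
Proof. by apply: prodr_ile1 => x _; rewrite absent_ge0 absent_le1. Qed.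

Lemma cluster_bound_ge0 A U Y : 0 <= cluster_bound A U Y.
Proof.
apply: prodr_ge0 => y _; have := prod_absent_ge0 Y y; have := prod_absent_le1 Y y.
by do !case: ifP => _; move: p_ge0 p_le1; lra.
Qed.

(* Exploring the edges at one vertex u of U turns its neighbours into sources
   and removes u from the graph: the factors of the bound are exactly preserved
   in mean by such a step. *)
Lemma cluster_law_le A U Y : U \subset A -> Y \subset A ->
  expect p (fun B => (cluster B A U == Y)%:R) <= cluster_bound A U Y.
Proof.
move: {2}#|A| (leqnn #|A|) => N; elim: N A U Y => [|N IH] A U Y.
  rewrite leqn0 cards_eq0 => /eqP -> ; rewrite !subset0 => /eqP -> /eqP ->.
  apply: le_trans (_ : expect p (fun=> 1) <= _).
    by apply: ler_expect => // B; rewrite lern1 leq_b1.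
  by rewrite expect_cst /cluster_bound big1 // => y; rewrite !inE.
move=> AN UA YA; have [U0|[u uU]] := set_0Vmem U.
  have cl0 B : cluster B A U = set0.
    apply/setP => y; rewrite !inE U0; apply/exists_inP => -[x].
    by rewrite inE.
  under eq_expect => B do rewrite cl0.
  rewrite expect_cst; have [<-|_] := eqVneq; last exact: cluster_bound_ge0.
  rewrite /cluster_bound big1 // => y; rewrite inE big_pred0 ?if_same //.
  by move=> x; rewrite inE.
have uA := subsetP UA u uU.
case: (boolP (u \in Y)) => uY; last first.
  apply: le_trans (cluster_bound_ge0 _ _ _); rewrite -(expect_cst E p 0).
  apply: ler_expect => // B; rewrite lern0 eqb0; apply/eqP => eqY.
  case/negP: uY; rewrite -eqY.
  exact: (subsetP (sub_cluster _ _ _)).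
have nbA B : nbhd B A u \subset A by apply/subsetP => x; rewrite inE => /andP[].
have srcA B : (U :|: nbhd B A u) :\ u \subset A :\ u.
  by apply: setSD; rewrite subUset UA nbA.
pose F B1 B2 : R := (nbhd B1 A u \subset Y)%:R *
  (cluster B2 (A :\ u) ((U :|: nbhd B1 A u) :\ u) == Y :\ u)%:R.
apply: (@le_trans _ _ (expect p (fun B => F B B))).
  apply: ler_expect => // B; rewrite /F -natrM mulnb ler_nat.
  case: eqP => // <-; rewrite lt0b; apply/andP; split.
    apply/subsetP => x; rewrite inE => /andP[xA aux].
    by apply: cluster_step aux xA; apply: (subsetP (sub_cluster _ _ _)).
  rewrite (cluster_explore _ uU UA) setU1K //.
  apply/negP => /(subsetP (cluster_sub _ (srcA B))).
  by rewrite !inE eqxx.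
(* The labels at [u] determine its neighbourhood; the cluster in the graph without [u] depends only
   on the other labels. *)
pose D := [set e | [exists y, ed u y == Some e]].
rewrite (@expect_decouple _ _ p D); last first.
  move=> B1 B1' B2 B2' /setP BD /setP BD'.
  have eN : nbhd B1 A u = nbhd B1' A u.
    apply/setP => y; rewrite !inE; congr (_ && _).
    apply: adj_local => e ey; have := BD e; rewrite !in_setI.
    have -> : e \in D by rewrite in_set; apply/existsP; exists y; rewrite ey.
    by rewrite !andbT.
  suff cE : cluster B2 (A :\ u) ((U :|: nbhd B1' A u) :\ u) =
            cluster B2' (A :\ u) ((U :|: nbhd B1' A u) :\ u) by rewrite /F eN cE.
  apply: cluster_local => // x y; rewrite !inE => /andP[xu _] /andP[yu _].
  apply: adj_local => e exy; have := BD' e; rewrite !in_setD.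
  case: (boolP (e \in D)) => //; rewrite in_set => /existsP[z /eqP ez] _.
  by case: (ed_inj exy ez) => -[ux _]; [rewrite ux eqxx in xu | rewrite ux eqxx in yu].
pose c y := \prod_(x in Y :\ u) absent x y.
have cE y : \prod_(x in Y) absent x y = absent u y * c y.
  by rewrite (big_setD1 u).
(* Factor of [y] in the bound for the graph without [u], where [b] tells whether [y] is adjacent to
   [u]. An adjacent vertex of [A] outside [Y] gives 0, and averaging over [b] restores the factor of
   [y] in the original bound. *)
pose phi y b : R := if y \in Y then if y \in U then 1 else if b then 1 else 1 - c y
                    else if y \in A then if b then 0 else c y else 1.
apply: (@le_trans _ _ (expect p (fun B => \prod_y phi y (adj B u y)))); last first.
  rewrite expect_prod_adj le_eqVlt; apply/orP; left; apply/eqP.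
  by apply: eq_bigr => y _; rewrite cE /phi; do !case: ifP => _; ring.
apply: ler_expect => // B1.
have -> : expect p (F B1) = (nbhd B1 A u \subset Y)%:R * expect p (fun B2 =>
    (cluster B2 (A :\ u) ((U :|: nbhd B1 A u) :\ u) == Y :\ u)%:R).
  by rewrite mulr_sumr; apply: eq_bigr => B2 _; rewrite mulrCA.
case: (boolP (nbhd B1 A u \subset Y)) => NY; last first.
  rewrite mul0r; apply: prodr_ge0 => y _.
  have := prod_absent_ge0 (Y :\ u) y; have := prod_absent_le1 (Y :\ u) y.
  by rewrite -/(c y) /phi; do !case: ifP => _; move: p_ge0 p_le1; lra.
rewrite mul1r.
apply: le_trans (IH _ _ (Y :\ u) _ (srcA B1) (setSD _ YA)) _.
  by have := AN; rewrite (cardsD1 u A) uA.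
rewrite le_eqVlt; apply/orP; left; apply/eqP.
apply: eq_bigr => y _; rewrite /phi -/(c y) !inE.
have [->|yu] /= := eqVneq y u; first by rewrite uY uU.
have [yY|yY] := boolP (y \in Y).
  rewrite (subsetP YA) //=; by case: (y \in U) => //; case: (adj _ _ _).
have [yA|//] := boolP (y \in A).
case: (boolP (adj _ _ _)) => // auy; case/negP: yY.
by apply: (subsetP NY); rewrite inE yA.
Qed.

End Percolation.

(** * The law of the reached set in the random bipartite graph *)

Section Binomial.
Import ring lra.
Local Open Scope ring_scope.

Definition binom_pmf (R : realFieldType) (N : nat) (pi : R) (j : nat) : R :=
  'C(N, j)%:R * pi ^+ j * (1 - pi) ^+ (N - j).

(** For [j <= N] the left side is one term of the binomial expansion of the right side, whose terms
    are all nonnegative. *)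
Lemma binom_pmf_chernoff (R : realFieldType) N (pi x : R) j :
  0 <= pi <= 1 -> 0 <= x -> binom_pmf N pi j * x ^+ j <= (1 + pi * (x - 1)) ^+ N.
Proof.
move=> /andP[pi0 pi1] x0; have [jN|Nj] := leqP j N; last first.
  by rewrite /binom_pmf bin_small // !mul0r exprn_ge0 //; nra.
have -> : 1 + pi * (x - 1) = (1 - pi) + pi * x by ring.
have xp0 : 0 <= pi * x by rewrite mulr_ge0.
rewrite exprDn (bigD1 (inord j : 'I_N.+1)) //= inordK //.
have -> : binom_pmf N pi j * x ^+ j = ((1 - pi) ^+ (N - j) * (pi * x) ^+ j) *+ 'C(N, j).
  by rewrite /binom_pmf -mulr_natl exprMn; ring.
rewrite lerDl; apply: sumr_ge0 => i _.
by rewrite mulrn_wge0 // mulr_ge0 // exprn_ge0 // subr_ge0.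
Qed.

Lemma binom_pmf_ge0 (R : realFieldType) N (pi : R) j : 0 <= pi <= 1 -> 0 <= binom_pmf N pi j.
Proof. by move=> /andP[pi0 pi1]; rewrite /binom_pmf !mulr_ge0 ?exprn_ge0 ?subr_ge0. Qed.

Lemma card_setC_ord n (U : {set 'I_n}) : #|~: U| = (n - #|U|)%N.
Proof. by rewrite cardsCs setCK card_ord. Qed.

Lemma card_supersets (n k : nat) (U : {set 'I_n}) : (#|U| <= k)%N ->
  (#|[set S : {set 'I_n} | (U \subset S) && (#|S| == k)]| <= 'C(n - #|U|, k - #|U|))%N.
Proof.
move=> Uk; rewrite -card_setC_ord -cards_draws.
set F := [set S | _].
have inj : {in F &, injective (fun S => S :\: U)}.
  move=> S S'; rewrite !inE => /andP[/setIidPr US _] /andP[/setIidPr US' _] SS'.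
  by rewrite -[S](setID _ U) -[S'](setID _ U) US US' SS'.
rewrite -(card_in_imset inj).
apply/subset_leq_card/subsetP => A /imsetP[S]; rewrite [S \in F]inE => /andP[US /eqP Sk] ->.
by rewrite inE setDE subsetIr /= -setDE cardsD (setIidPr US) Sk.
Qed.

End Binomial.

Section Bipartite.
Import ring lra.
Local Open Scope ring_scope.
Variables (R : realFieldType) (n m : nat) (p : R).
Hypotheses (p_ge0 : 0 <= p) (p_le1 : p <= 1).
Local Notation q := (1 - p).

Definition bip_edge (x y : 'I_n + 'I_m) : option ('I_n * 'I_m) :=
  match x, y with
  | inl i, inr k | inr k, inl i => Some (i, k)
  | _, _ => None
  end.

Lemma bip_edge_inj e x y u z : bip_edge x y = Some e -> bip_edge u z = Some e ->
  (u = x /\ z = y) \/ (u = y /\ z = x).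
Proof.
by move: x y u z => [i|k] [i'|k'] [j|l] [j'|l'] //= -[<-] [-> ->]; [left|right|right|left].
Qed.

Definition bip_set (S : {set 'I_n}) (T : {set 'I_m}) : {set 'I_n + 'I_m} :=
  [set x | match x with inl i => i \in S | inr k => k \in T end].

Lemma bip_cluster_bound (U S : {set 'I_n}) (T : {set 'I_m}) : U \subset S ->
  cluster_bound p bip_edge setT (bip_set U set0) (bip_set S T) =
  (1 - q ^+ #|T|) ^+ (#|S| - #|U|) * (q ^+ #|T|) ^+ (n - #|S|) *
  ((1 - q ^+ #|S|) ^+ #|T| * (q ^+ #|S|) ^+ (m - #|T|)).
Proof.
move=> US; have absl i : \prod_(x in bip_set S T) absent p bip_edge x (inl i) = q ^+ #|T|.
  rewrite big_sumType /= big1 ?mul1r // -prodr_const.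
  by apply: eq_bigl => k; rewrite inE.
have absr k : \prod_(x in bip_set S T) absent p bip_edge x (inr k) = q ^+ #|S|.
  rewrite big_sumType /= mulrC big1 ?mul1r // -prodr_const.
  by apply: eq_bigl => i; rewrite inE.
rewrite /cluster_bound big_sumType /=; congr (_ * _).
  under eq_bigr => i _ do rewrite absl !inE /=.
  rewrite (bigID (mem S)) /=; congr (_ * _).
    rewrite (bigID (mem U)) /= big1 ?mul1r => [|i /andP[-> ->] //].
    have -> : (#|S| - #|U| = #|S :\: U|)%N by rewrite cardsD (setIidPr US).
    rewrite -prodr_const.
    apply: eq_big => i; first by rewrite !inE andbC.
    by move=> /andP[-> /negbTE ->].
  rewrite -card_setC_ord -prodr_const.
  by apply: eq_big => i; rewrite ?inE // => /negbTE ->.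
under eq_bigr => k _ do rewrite absr !inE /=.
rewrite (bigID (mem T)) /=; congr (_ * _).
  by rewrite -[RHS]prodr_const; apply: eq_bigr => k ->.
rewrite -card_setC_ord -[RHS]prodr_const.
by apply: eq_big => k; rewrite ?inE // => /negbTE ->.
Qed.

Definition reach (U : {set 'I_n}) (B : {set 'I_n * 'I_m}) : {set 'I_n} :=
  [set i | inl i \in cluster bip_edge B setT (bip_set U set0)].

Lemma sub_reach (U : {set 'I_n}) (B : {set 'I_n * 'I_m}) : U \subset reach U B.
Proof.
by apply/subsetP => i iU; rewrite inE; apply: (subsetP (sub_cluster _ _ _ _)); rewrite inE.
Qed.

(** Union bound over the reached sets of vertices and of auxiliary vertices. The cluster bound
    depends only on their sizes [k] and [l], and the numbers of choices supply the two binomial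
    coefficients. *)
Lemma reach_size_law_le (U : {set 'I_n}) k :
  expect p (fun B => (#|reach U B| == k)%:R) <=
  \sum_(l < m.+1) binom_pmf m (1 - q ^+ k) l *
                  binom_pmf (n - #|U|) (1 - q ^+ l) (k - #|U|).
Proof.
have q01 j : 0 <= 1 - q ^+ j <= 1.
  have q0 : 0 <= q by move: p_le1; lra.
  have q1 : q <= 1 by move: p_ge0; lra.
  have := exprn_ge0 j q0; have := exprn_ile1 j q0 q1; lra.
(* If [k < #|U|] the subtraction [k - #|U|] truncates, but then the event is empty, since [U] is
   contained in its reach. *)
have [kU|Uk] := ltnP k #|U|.
  apply: (@le_trans _ _ 0).
    rewrite -(expect_cst ('I_n * 'I_m)%type p 0); apply: ler_expect => // B; rewrite lern0 eqb0.
    apply: contraTneq kU => <-; rewrite -leqNgt; exact: subset_leq_card (sub_reach _ _).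
  by apply: sumr_ge0 => l _; rewrite mulr_ge0 ?binom_pmf_ge0.
pose C B := cluster bip_edge B setT (bip_set U set0).
pose Sk := [set S : {set 'I_n} | (U \subset S) && (#|S| == k)].
apply: (@le_trans _ _ (expect p (fun B => \sum_(l < m.+1) \sum_(S in Sk)
    \sum_(T : {set 'I_m} | #|T| == l) (C B == bip_set S T)%:R))).
  apply: ler_expect => // B; case: eqP => [Bk|_]; last first.
    by do 3![apply: sumr_ge0 => ? _].
  pose T := [set j | inr j \in C B].
  have Tm : (#|T| < m.+1)%N by rewrite ltnS -[X in (_ <= X)%N](card_ord m) max_card.
  rewrite (bigD1 (Ordinal Tm)) //= (bigD1 (reach U B)) /=; last first.
    by rewrite inE sub_reach Bk eqxx.
  rewrite (bigD1 T) //=.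
  have -> : C B == bip_set (reach U B) T by apply/eqP/setP => -[i|j]; rewrite !inE.
  rewrite -!addrA lerDl !addr_ge0 //; do ?[apply: sumr_ge0 => ? _]; by [].
rewrite /expect; under eq_bigr => B _ do rewrite mulr_sumr.
rewrite exchange_big /=; apply: ler_sum => l _.
under eq_bigr => B _ do rewrite mulr_sumr.
rewrite exchange_big /=.
pose V : R := (1 - q ^+ l) ^+ (k - #|U|) * (q ^+ l) ^+ (n - k) *
  ((1 - q ^+ k) ^+ l * (q ^+ k) ^+ (m - l)).
have V0 : 0 <= V.
  have q0 : 0 <= q by move: p_le1; lra.
  have /andP[? _] := q01 l; have /andP[? _] := q01 k.
  by rewrite /V !mulr_ge0 ?exprn_ge0.
apply: (@le_trans _ _ (\sum_(S in Sk) \sum_(T : {set 'I_m} | #|T| == l) V)).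
  apply: ler_sum => S; rewrite inE => /andP[US /eqP Sk'].
  under eq_bigr => B _ do rewrite mulr_sumr.
  rewrite exchange_big /=; apply: ler_sum => T /eqP Tl.
  apply: le_trans (cluster_law_le p_ge0 p_le1 bip_edge_inj (subsetT _) (subsetT _)) _.
  by rewrite bip_cluster_bound // Sk' Tl.
rewrite !sumr_const.
have -> : #|(fun T : {set 'I_m} => #|T| == l)| = 'C(m, l).
  by rewrite -[X in 'C(X, _)]card_ord -card_draws; apply: eq_card => T; rewrite !inE.
apply: (@le_trans _ _ (V *+ 'C(m, l) *+ 'C(n - #|U|, k - #|U|))).
  by apply: ler_wpMn2l; [rewrite mulrn_wge0|exact: card_supersets].
rewrite le_eqVlt; apply/orP; left; apply/eqP.
have compl j : 1 - (1 - q ^+ j) = q ^+ j by ring.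
have Un : (#|U| <= n)%N by rewrite -[X in (_ <= X)%N](card_ord n) max_card.
rewrite /binom_pmf !compl subnBA // subnK // -(mulr_natl _ 'C(n - _, _)) -(mulr_natl V) /V.
by ring.
Qed.

End Bipartite.

(** * Chernoff bounds *)

Delimit Scope ring_scope with Rg.
Delimit Scope R_scope with R.
Local Open Scope R_scope.
Local Arguments binom_pmf {R} N%_nat_scope pi%_R_scope j%_nat_scope.

Lemma exp_le_inv t : 0 <= t -> exp (- t) <= / (1 + t).
Proof.
move=> t0; rewrite exp_Ropp; apply: Rinv_le_contravar; first lra.
have := exp_ineq1_le t; lra.
Qed.

Lemma exp_le x y : x <= y -> exp x <= exp y.
Proof. by case=> [xy|->]; [left; apply: exp_increasing|right]. Qed.

Lemma pow_exp s j : exp s ^ j = exp (s * INR j).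
Proof.
elim: j => [|j IH]; first by rewrite /= Rmult_0_r exp_0.
by rewrite S_INR -tech_pow_Rmult IH -exp_plus; congr exp; lra.
Qed.

Lemma Rpow_ringE (x : R) j : GRing.exp x j = x ^ j.
Proof. by rewrite RpowE. Qed.

(** The tilt [x] need only lie above [exp (- s)], so it can be chosen rational in the deviation,
    which leaves polynomial inequalities. *)
Lemma binom_pmf_le_exp N pi x s j : 0 <= pi <= 1 -> exp (- s) <= x ->
  binom_pmf N pi j <= exp (INR N * pi * (x - 1) + s * INR j).
Proof.
move=> [pi0 pi1] sx; have sp := exp_pos (- s).
have pi01 : (Order.le 0%R pi && Order.le pi 1%R) by apply/andP; split; apply/RleP.
have b0 : 0 <= binom_pmf N pi j by apply/RleP/binom_pmf_ge0.
have x0 : Order.le 0%R x by apply/RleP; lra.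
have /RleP := binom_pmf_chernoff N j pi01 x0.
rewrite -RmultE !Rpow_ringE => bx.
have bE : binom_pmf N pi j * exp (- s) ^ j <= exp (pi * (x - 1)) ^ N.
  apply: Rle_trans (Rle_trans _ _ _ bx _).
    by apply: Rmult_le_compat_l => //; apply: pow_incr; lra.
  apply: pow_incr; split; last exact: exp_ineq1_le.
  rewrite -RplusE; change (0 <= 1 + pi * (x - 1)); nra.
move: bE; rewrite !pow_exp => bE.
apply: (Rmult_le_reg_r (exp (- s * INR j))); first exact: exp_pos.
rewrite -exp_plus; apply: Rle_trans bE _.
by apply: Req_le; congr exp; lra.
Qed.

Lemma binom_pmf_le1 N pi j : 0 <= pi <= 1 -> binom_pmf N pi j <= 1.
Proof.
move=> pi01; apply: Rle_trans (@binom_pmf_le_exp N pi 1 0 j pi01 _) _.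
  by rewrite Ropp_0 exp_0; lra.
by apply: Req_le; rewrite -exp_0; congr exp; lra.
Qed.

Lemma chernoff_lower N pi j eta M : 0 <= pi <= 1 -> 0 < eta <= 1 -> 0 <= M ->
  M <= INR N * pi -> INR j <= (1 - eta) * M ->
  binom_pmf N pi j <= exp (- (eta ^ 2 / 4 * M)).
Proof.
(* The tilt [/ (1 + t)] is at least [1 - t], so the exponent is at most [- t ^ 2 * M], that is
   [- (eta ^ 2 / 4 * M)]. *)
move=> pi01 e01 M0 MN jM; pose t := eta / 2.
have t01 : 0 < t <= / 2 by rewrite /t; lra.
apply: Rle_trans (@binom_pmf_le_exp N pi (/ (1 + t)) t j pi01 _) _.
  by apply: exp_le_inv; lra.
apply: exp_le; set y := / (1 + t).
have yt : y * (1 + t) = 1 by rewrite /y; field; lra.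
have y1 : 1 - t <= y by nra.
have y2 : y <= 1 by nra.
have -> : eta = 2 * t by rewrite /t; lra.
have eE : eta = 2 * t by rewrite /t; lra.
rewrite eE in jM.
have a1 : INR N * pi * (y - 1) <= M * (y - 1) by nra.
have a2 : t * INR j <= t * ((1 - 2 * t) * M) by apply: Rmult_le_compat_l => //; lra.
have a3 : y - 1 = - (t * y) by lra.
rewrite a3 in a1 *.
have a4 : t * M * (1 - t) <= t * M * y by apply: Rmult_le_compat_l => //; nra.
lra.
Qed.

(** The rate is expressed through [j], because [M] may be much smaller than [j], even zero. *)
Lemma chernoff_upper N pi j eta M : 0 <= pi <= 1 -> 0 < eta <= 1 ->
  INR N * pi <= M -> (1 + eta) * M <= INR j ->
  binom_pmf N pi j <= exp (- (eta ^ 2 / 12 * INR j)).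
Proof.
move=> pi01 e01 NM Mj; pose t := eta / 2.
have t01 : 0 < t <= / 2 by rewrite /t; lra.
set y := / (1 + t).
have yt : y * (1 + t) = 1 by rewrite /y; field; lra.
have y0 : 0 < y by apply: Rinv_0_lt_compat; lra.
apply: Rle_trans (@binom_pmf_le_exp N pi (1 + t) (- (t * y)) j pi01 _) _.
  rewrite Ropp_involutive.
  have := @exp_ineq1_le (- (t * y)); rewrite exp_Ropp => h.
  have e0 := exp_pos (t * y); have ei : / exp (t * y) * exp (t * y) = 1 by field; lra.
  have : y * exp (t * y) <= 1 by nra.
  nra.
apply: exp_le.
have eE : eta = 2 * t by rewrite /t; lra.
rewrite eE in Mj *.
have j0 := pos_INR j; have N0 := pos_INR N.
have -> : 1 + t - 1 = t by lra.
have a1 : INR N * pi * t <= M * t by apply: Rmult_le_compat_r => //; lra.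
(* As [M <= j z], the exponent is at most [- j t (y - z) = - j t ^ 2 y z], and [y z >= / 3] for
   [t <= / 2] yields the constant [eta ^ 2 / 12]. *)
set z := / (1 + 2 * t).
have zt : z * (1 + 2 * t) = 1 by rewrite /z; field; lra.
have z0 : 0 < z by apply: Rinv_0_lt_compat; lra.
have Mz : M <= INR j * z.
  apply: (Rmult_le_reg_r (1 + 2 * t)); first lra.
  by rewrite Rmult_assoc zt; lra.
have yz : y - z = t * (y * z).
  apply: (Rmult_eq_reg_r ((1 + t) * (1 + 2 * t))); last nra.
  transitivity (y * (1 + t) * (1 + 2 * t) - z * (1 + 2 * t) * (1 + t)); first ring.
  transitivity (t * (y * (1 + t)) * (z * (1 + 2 * t))); last ring.
  by rewrite yt zt; ring.
have yz3 : / 3 <= y * z.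
  have y3 : 2 / 3 <= y by nra.
  have z3 : / 2 <= z by nra.
  nra.
have a2 : M * t <= INR j * z * t by apply: Rmult_le_compat_r => //; lra.
have a3 : INR j * t * (t * / 3) <= INR j * t * (t * (y * z)).
  by apply: Rmult_le_compat_l; [nra|apply: Rmult_le_compat_l; lra].
rewrite -yz in a3; lra.
Qed.

(** * The fixed points of h *)

(** Strict concavity of [1 - exp (- y)], which vanishes at 0: [exp] is compared at [- y] and at 0
    with its tangent at [- (t * y)]. *)
Lemma exp_scale_lt t y : 0 < t < 1 -> 0 < y -> t * (1 - exp (- y)) < 1 - exp (- (t * y)).
Proof.
move=> t01 y0; set a := exp (- (t * y)).
have a0 : 0 < a by apply: exp_pos.
have ey : exp (- y) = a * exp (- ((1 - t) * y)) by rewrite /a -exp_plus; congr exp; lra.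
have e1 : 1 = a * exp (t * y) by rewrite /a -exp_plus -exp_0; congr exp; lra.
have i1 := @exp_ineq1_le (- ((1 - t) * y)).
have i2 : 1 + t * y < exp (t * y) by apply: exp_ineq1; nra.
have j1 : t * (a * (1 + - ((1 - t) * y))) <= t * exp (- y).
  by rewrite ey; apply: Rmult_le_compat_l; [lra|apply: Rmult_le_compat_l; lra].
have j2 : (1 - t) * (a * (1 + t * y)) < (1 - t) * (a * exp (t * y)).
  by apply: Rmult_lt_compat_l; [lra|apply: Rmult_lt_compat_l].
rewrite -e1 in j2; lra.
Qed.

Lemma exp_scale_le t y : 0 <= t <= 1 -> 0 <= y -> t * (1 - exp (- y)) <= 1 - exp (- (t * y)).
Proof.
move=> [[t0|<-] [t1|->]] [y0|<-];
  rewrite ?Rmult_0_l ?Rmult_0_r ?Rmult_1_l ?Ropp_0 ?exp_0; try lra.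
by left; apply: exp_scale_lt.
Qed.

Lemma exp_scale_ge t y : 1 <= t -> 0 <= y -> 1 - exp (- (t * y)) <= t * (1 - exp (- y)).
Proof.
move=> t1 y0; have i1 : 0 < / t by apply: Rinv_0_lt_compat; lra.
have it : / t * t = 1 by field; lra.
have := @exp_scale_le (/ t) (t * y); rewrite -Rmult_assoc it Rmult_1_l => h.
have {}h : / t * (1 - exp (- (t * y))) <= 1 - exp (- y) by apply: h; nra.
apply: (Rmult_le_reg_l (/ t)) => //; rewrite -Rmult_assoc it; lra.
Qed.

Lemma one_sub_exp_mono x y : x <= y -> 1 - exp (- x) <= 1 - exp (- y).
Proof. by move=> xy; have := @exp_le (- y) (- x); lra. Qed.

Lemma one_sub_exp_ge0 x : 0 <= x -> 0 <= 1 - exp (- x).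
Proof. by move=> x0; have := @exp_le (- x) 0; rewrite exp_0; lra. Qed.

Lemma one_sub_exp_le x : 1 - exp (- x) <= x.
Proof. by have := @exp_ineq1_le (- x); lra. Qed.

Lemma one_sub_exp_ge x : 0 <= x -> x <= (1 - exp (- x)) * (1 + x).
Proof.
move=> x0; have := exp_le_inv x0.
have : / (1 + x) * (1 + x) = 1 by field; lra.
nra.
Qed.

Section FixedPoint.
Variables (beta gamma : R).
Hypotheses (beta_gt0 : 0 < beta) (gamma_gt0 : 0 < gamma).

(** When a fraction [x] of the vertices is reached, about [n * aux_frac x] auxiliary vertices are
    joined to them, and these in turn to a fraction [reach_map x] of the vertices; [reach_map] is
    the function h. *)
Definition aux_frac x := beta * (1 - exp (- (gamma * x))).
Definition reach_map x := 1 - exp (- (gamma * aux_frac x)).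

Lemma reach_map_g x : reach_map x = 1 - g beta gamma (1 - x).
Proof.
rewrite /reach_map /aux_frac /g; congr (1 - exp _).
have -> : gamma * (1 - x - 1) = - (gamma * x) by ring.
ring.
Qed.

Lemma aux_frac_ge0 x : 0 <= x -> 0 <= aux_frac x.
Proof.
by move=> x0; apply: Rmult_le_pos; [lra|apply: one_sub_exp_ge0; nra].
Qed.

Lemma reach_map_le x : 0 <= x -> reach_map x <= beta * gamma ^ 2 * x.
Proof.
move=> x0; apply: Rle_trans (one_sub_exp_le _) _.
have := one_sub_exp_le (gamma * x); rewrite /aux_frac => h.
have : gamma * (beta * (1 - exp (- (gamma * x)))) <= gamma * (beta * (gamma * x)).
  by do 2![apply: Rmult_le_compat_l; first lra].
lra.
Qed.

(** Strict decrease of h(x)/x, cleared of denominators: h is composed of two increasing concave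
    functions vanishing at 0, so the scaling inequality applies twice. *)
Lemma reach_map_star x y : 0 < x < y -> reach_map y * x < reach_map x * y.
Proof.
move=> [x0 xy]; pose t := x / y.
have y0 : 0 < y by lra.
have xE : x = t * y by rewrite /t; field; lra.
have t01 : 0 < t < 1.
  split; first by apply: Rdiv_lt_0_compat.
  by apply: (Rmult_lt_reg_r y) => //; rewrite -xE; lra.
suff lt : t * reach_map y < reach_map x.
  have -> : reach_map y * x = t * reach_map y * y by rewrite {1}xE; ring.
  exact: Rmult_lt_compat_r.
have gy : 0 < gamma * y by nra.
have a0 : 0 < aux_frac y.
  apply: Rmult_lt_0_compat => //.
  have := @exp_increasing (- (gamma * y)) 0; rewrite exp_0; lra.
have a1 : t * aux_frac y <= aux_frac x.
  rewrite /aux_frac xE; have := @exp_scale_le t (gamma * y).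
  have -> : gamma * (t * y) = t * (gamma * y) by ring.
  nra.
apply: Rlt_le_trans (@exp_scale_lt t (gamma * aux_frac y) t01 _) _; first nra.
by apply: one_sub_exp_mono; nra.
Qed.

Lemma reach_map_lt1 x : reach_map x < 1.
Proof. by rewrite /reach_map; have := exp_pos (- (gamma * aux_frac x)); lra. Qed.

Lemma reach_map_continuous : continuity reach_map.
Proof.
by move=> x; apply: derivable_continuous_pt; rewrite /reach_map /aux_frac; reg.
Qed.

Lemma reach_map_fixpoint : 1 < beta * gamma ^ 2 ->
  exists2 x, 0 < x < 1 & reach_map x = x.
Proof.
move=> mu1; set mu := beta * gamma ^ 2 in mu1.
(* For [0 < x <= 1], [(1 + mu x)(1 + gamma x) <= 1 + C x], which is below [mu] when
   [2 C x <= mu - 1]. Using [1 - exp (- s) >= s / (1 + s)] twice then gives [x < reach_map x], and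
   the intermediate value theorem on [[x, 1]] applies. *)
pose C := gamma + mu + gamma * mu.
have C0 : 0 < C by rewrite /C; nra.
pose x := Rmin (/ 2) ((mu - 1) / (2 * C)).
have x1 : x <= / 2 by apply: Rmin_l.
have xC : x * (2 * C) <= mu - 1.
  have : x <= (mu - 1) / (2 * C) by apply: Rmin_r.
  move=> /(Rmult_le_compat_r (2 * C)); rewrite /Rdiv Rmult_assoc Rinv_l; nra.
have x0 : 0 < x.
  by apply: Rmin_glb_lt; [lra|apply: Rdiv_lt_0_compat; lra].
have hx : x < reach_map x.
  have gx : 0 < gamma * x by nra.
  have a0 := @aux_frac_ge0 x; set a := aux_frac x in a0 *.
  have {}a0 : 0 <= a by lra.
  have h1 : gamma * (beta * (gamma * x)) <= gamma * a * (1 + gamma * x).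
    have := @one_sub_exp_ge (gamma * x); rewrite /a /aux_frac.
    set e := 1 - exp _ => he.
    have k : gamma * x <= e * (1 + gamma * x) by apply: he; lra.
    have : beta * gamma * (gamma * x) <= beta * gamma * (e * (1 + gamma * x)).
      by apply: Rmult_le_compat_l => //; nra.
    lra.
  have ga0 : 0 <= gamma * a by nra.
  have a2 : gamma * a <= mu * x.
    have := one_sub_exp_le (gamma * x); rewrite /a /aux_frac /mu => h.
    have : gamma * beta * (1 - exp (- (gamma * x))) <= gamma * beta * (gamma * x).
      by apply: Rmult_le_compat_l; nra.
    lra.
  have h3 : gamma * a <= (1 - exp (- (gamma * a))) * (1 + gamma * a).
    exact: one_sub_exp_ge.
  rewrite /reach_map -/a; set e := 1 - _ in h3 *.
  have e0 : 0 <= e by apply: one_sub_exp_ge0.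
  have h4 : mu * x <= e * ((1 + mu * x) * (1 + gamma * x)).
    have k : gamma * a <= e * (1 + mu * x).
      have := Rmult_le_compat_l e _ _ e0 a2; lra.
    have : gamma * a * (1 + gamma * x) <= e * (1 + mu * x) * (1 + gamma * x).
      by apply: Rmult_le_compat_r => //; nra.
    rewrite /mu in h1 *; lra.
  have h5 : (1 + mu * x) * (1 + gamma * x) < mu.
    have : mu * gamma * (x * x) <= mu * gamma * x.
      by apply: Rmult_le_compat_l; [apply: Rmult_le_pos|]; nra.
    by rewrite /C in xC *; lra.
  case: (Rlt_le_dec x e) => // ex.
  have : e * ((1 + mu * x) * (1 + gamma * x)) <= x * ((1 + mu * x) * (1 + gamma * x)).
    by apply: Rmult_le_compat_r => //; nra.
  nra.
have [z [xz zE]] : {z | x <= z <= 1 & (z - reach_map z) = 0}.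
  have cont : continuity (fun z => z - reach_map z).
    apply: continuity_minus; last exact: reach_map_continuous.
    exact: derivable_continuous derivable_id.
  have [||z [xz zE]] := @IVT_cor (fun z => z - reach_map z) x 1 cont; first lra.
    by have := reach_map_lt1 1; nra.
  by exists z.
have z1 := reach_map_lt1 z.
by exists z; lra.
Qed.

(** The substitution [x = 1 - s] turns roots of [s = g(s)] into fixed points of h and the trivial
    root 1 into 0. As h(x)/x strictly decreases, h has only one positive fixed point. *)
Lemma smallest_fixpointP rho : 1 < beta * gamma ^ 2 ->
  smallest_fixpoint beta gamma rho <-> 0 < 1 - rho < 1 /\ reach_map (1 - rho) = 1 - rho.
Proof.
move=> mu1.
have uniq x y : 0 < x -> 0 < y -> reach_map x = x -> reach_map y = y -> x = y.
  move=> x0 y0 hx hy; case: (Rtotal_order x y) => [xy|[//|yx]].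
    have := @reach_map_star x y; rewrite hx hy; lra.
  have := @reach_map_star y x; rewrite hx hy; lra.
have fixE s : s = g beta gamma s <-> reach_map (1 - s) = 1 - s.
  rewrite reach_map_g; have -> : 1 - (1 - s) = s by lra.
  lra.
have [x x01 hx] := reach_map_fixpoint mu1.
have small r : 0 < 1 - r < 1 -> reach_map (1 - r) = 1 - r -> smallest_fixpoint beta gamma r.
  move=> r01 hr; split; first lra; split; first exact/fixE.
  move=> s s0 /fixE hs; case: (Rle_lt_dec r s) => // sr.
  have := @uniq (1 - r) (1 - s); lra.
split=> [[r0 [/fixE hr rmin]]|[]]; last exact: small.
have hx' : reach_map (1 - (1 - x)) = 1 - (1 - x) by rewrite (_ : 1 - (1 - x) = x); lra.
have := rmin (1 - x) _ (proj2 (fixE _) hx') => /(_ _) h.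
have rx : 0 < 1 - rho by lra.
have := uniq _ _ rx (proj1 x01) hr hx; lra.
Qed.

(** By monotonicity of h(x)/x, the relative gaps at [x0 - delta] and [x0 + delta] persist further
    away from [x0]. The clause [x0 <= x] later allows a seed set to be compared with [k]. *)
Lemma reach_map_gap x0 delta : 0 < x0 -> reach_map x0 = x0 -> 0 < delta ->
  exists2 eta, 0 < eta <= 1 & forall x, 0 < x -> delta <= Rabs (x - x0) ->
    (1 + eta) * x <= reach_map x \/ x0 <= x /\ reach_map x <= (1 - eta) * x.
Proof.
move=> x0_gt0 hx0 d0.
have [e1 e1_01 low] : exists2 eta, 0 < eta <= 1 &
    forall x, 0 < x -> x <= x0 - delta -> (1 + eta) * x <= reach_map x.
  case: (Rle_lt_dec (x0 - delta) 0) => [neg|pos]; first by exists 1; [lra|move=> x; lra].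
  set y := x0 - delta in pos *.
  have yx0 : y < x0 by rewrite /y; lra.
  have hy : x0 * y < reach_map y * x0.
    by have := @reach_map_star y x0; rewrite hx0; apply; lra.
  have hyy : y < reach_map y by nra.
  exists (Rmin 1 (reach_map y / y - 1)).
    split; last exact: Rmin_l.
    apply: Rmin_glb_lt; first lra.
    apply: (Rmult_lt_reg_r y) => //; rewrite Rmult_minus_distr_r /Rdiv Rmult_assoc Rinv_l; lra.
  move=> x xp xy.
  have h : reach_map y / y * x <= reach_map x.
    apply: (Rmult_le_reg_r y) => //.
    have -> : reach_map y / y * x * y = reach_map y * x by field; lra.
    case: xy => [xy|->]; last lra.
    by left; apply: reach_map_star; lra.
  have := Rmin_r 1 (reach_map y / y - 1); nra.
have [e2 e2_01 upp] : exists2 eta, 0 < eta <= 1 &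
    forall x, x0 + delta <= x -> reach_map x <= (1 - eta) * x.
  set y := x0 + delta.
  have yp : 0 < y by rewrite /y; lra.
  have hy : reach_map y * x0 < x0 * y.
    by have := @reach_map_star x0 y; rewrite hx0; apply; rewrite /y; lra.
  have hyy : reach_map y < y by nra.
  have yy : reach_map y / y * y = reach_map y by field; lra.
  exists (1 - reach_map y / y).
    have h0 : 0 <= reach_map y by apply: one_sub_exp_ge0; have := @aux_frac_ge0 y; nra.
    have : 0 <= reach_map y / y by apply: Rmult_le_pos => //; left; apply: Rinv_0_lt_compat.
    have : reach_map y / y < 1 by apply: (Rmult_lt_reg_r y) => //; rewrite yy; lra.
    lra.
  move=> x xy.
  have -> : (1 - (1 - reach_map y / y)) * x = reach_map y / y * x by ring.
  apply: (Rmult_le_reg_r y) => //.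
  have -> : reach_map y / y * x * y = reach_map y * x by field; lra.
  case: xy => [xy|<-]; last lra.
  by left; apply: reach_map_star; rewrite -/y; lra.
exists (Rmin e1 e2).
  by split; [apply: Rmin_glb_lt; lra|apply: Rle_trans (Rmin_l _ _) _; lra].
have m1 := Rmin_l e1 e2; have m2 := Rmin_r e1 e2.
move=> x xp; rewrite /Rabs; case: Rcase_abs => xx dx.
  by left; have := low x xp; nra.
by right; split; [lra|have := upp x; nra].
Qed.

End FixedPoint.

(** * Exponential decay off the diagonal *)

Section Decay.
Variables (beta gamma : R).
Hypotheses (beta_gt0 : 0 < beta) (gamma_gt0 : 0 < gamma).
Variables (eta : R) (n m k l u : nat).
Hypothesis eta01 : 0 < eta <= 1.
(* Small enough for (1 - eps)^4 (1 + eta) >= 1 and (1 + eps)^4 (1 - eta) <= 1 - eps. *)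
Let eps := eta / 16.
Hypotheses (n_gt0 : 0 < INR n) (k_gt0 : 0 < INR k) (kn : INR k <= INR n).
Hypothesis n_large : gamma / INR n * (1 + eps) <= eps.
Hypothesis m_bounds : (1 - eps) * (beta * INR n) <= INR m <= beta * INR n.
Let q := 1 - gamma / INR n.
Let x := INR k / INR n.
(** [A] is the limiting proportion of auxiliary vertices joined to [k] given vertices; [c1 * INR k]
    below is a lower bound for their mean number. *)
Let A := 1 - exp (- (gamma * x)).
Let c1 := beta * gamma / (2 * (1 + gamma)).

Let eps01 : 0 < eps <= / 16. Proof. rewrite /eps; move: eta01; lra. Qed.

Let y_gt0 : 0 < gamma / INR n. Proof. exact: Rdiv_lt_0_compat. Qed.

Let x01 : 0 < x <= 1.
Proof.
split; first exact: Rdiv_lt_0_compat.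
apply: (Rmult_le_reg_r (INR n)) => //.
rewrite /x /Rdiv Rmult_assoc Rinv_l; last by move: n_gt0; lra.
by move: kn; lra.
Qed.

Let kE : INR k = x * INR n.
Proof. by rewrite /x; field; move: n_gt0; lra. Qed.

Let q_le : q <= exp (- (gamma / INR n)).
Proof. by have := exp_ineq1_le (- (gamma / INR n)); rewrite /q; lra. Qed.

(** With [y = gamma / INR n], the product [(1 - y)(1 + (1 + eps) y)] is at least 1 as soon as
    [(1 + eps) y <= eps], which is [n_large]. *)
Let q_ge : exp (- ((1 + eps) * (gamma / INR n))) <= q.
Proof.
set y := gamma / INR n; have y0 := y_gt0; rewrite -/y in y0.
have e0 : 0 <= (1 + eps) * y by move: eps01; nra.
apply: Rle_trans (exp_le_inv e0) _.
have i : / (1 + (1 + eps) * y) * (1 + (1 + eps) * y) = 1 by field; lra.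
apply: (Rmult_le_reg_r (1 + (1 + eps) * y)); first lra.
rewrite i /q -/y; have := n_large; rewrite -/y; nra.
Qed.

Let q01 : 0 < q <= 1.
Proof.
split; first exact: Rlt_le_trans (exp_pos _) q_ge.
by move: y_gt0; rewrite /q; lra.
Qed.

Let qpow_le j : q ^ j <= exp (- (gamma / INR n * INR j)).
Proof.
have -> : - (gamma / INR n * INR j) = - (gamma / INR n) * INR j by ring.
by rewrite -pow_exp; apply: pow_incr; split; [case: q01; lra|exact: q_le].
Qed.

Let qpow_ge j : exp (- ((1 + eps) * (gamma / INR n * INR j))) <= q ^ j.
Proof.
have -> : - ((1 + eps) * (gamma / INR n * INR j)) = - ((1 + eps) * (gamma / INR n)) * INR j by ring.
by rewrite -pow_exp; apply: pow_incr; split; [left; apply: exp_pos|exact: q_ge].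
Qed.

Let qpow01 j : 0 <= 1 - q ^ j <= 1.
Proof.
have q0 := q01; have : 0 <= q ^ j <= 1 ^ j.
  by split; [apply: pow_le; lra|apply: pow_incr; lra].
by rewrite pow1; lra.
Qed.

Let ykE : gamma / INR n * INR k = gamma * x.
Proof. by rewrite /x /Rdiv; ring. Qed.

Let A_le : A <= 1 - q ^ k.
Proof. by have := qpow_le k; rewrite ykE /A; lra. Qed.

Let A_ge : 1 - q ^ k <= (1 + eps) * A.
Proof.
have := qpow_ge k; rewrite ykE => h.
have := @exp_scale_ge (1 + eps) (gamma * x); rewrite -/A.
have := eps01; have := x01; have := gamma_gt0; nra.
Qed.

Let A_lin : gamma * x / (1 + gamma) <= A.
Proof.
have gx : 0 < gamma * x <= gamma by have := x01; have := gamma_gt0; nra.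
have A0 : 0 <= A by apply: one_sub_exp_ge0; lra.
apply: (Rmult_le_reg_r (1 + gamma)); first lra.
have -> : gamma * x / (1 + gamma) * (1 + gamma) = gamma * x by field; lra.
have : gamma * x <= A * (1 + gamma * x) by apply: one_sub_exp_ge; lra.
nra.
Qed.

Let mean_lin : c1 * INR k <= INR m * (1 - q ^ k).
Proof.
have A0 : 0 <= A.
  apply: Rle_trans A_lin; apply: Rmult_le_pos; first by have := x01; nra.
  by left; apply: Rinv_0_lt_compat; lra.
apply: (@Rle_trans _ (INR m * A)); last by apply: Rmult_le_compat_l; [exact: pos_INR|exact: A_le].
have bn : 0 < beta * INR n by nra.
apply: (@Rle_trans _ (/ 2 * (beta * INR n) * A)); last first.
  by apply: Rmult_le_compat_r => //; have := m_bounds; have := eps01; nra.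
have -> : c1 * INR k = / 2 * (beta * INR n) * (gamma * x / (1 + gamma)).
  by rewrite /c1 kE; field; lra.
by apply: Rmult_le_compat_l A_lin; lra.
Qed.

Let c1_gt0 : 0 < c1.
Proof. by apply: Rdiv_lt_0_compat; nra. Qed.

Let term := binom_pmf m (1 - q ^ k) l * binom_pmf (n - u) (1 - q ^ l) (k - u).

Let pmf_ge0 N j j' : 0 <= binom_pmf N (1 - q ^ j) j'.
Proof.
have [h0 h1] := qpow01 j; apply/RleP/binom_pmf_ge0.
by apply/andP; split; apply/RleP.
Qed.

Let term_le1 b : binom_pmf m (1 - q ^ k) l <= b -> term <= b.
Proof.
have := @binom_pmf_le1 (n - u) (1 - q ^ l) (k - u) (qpow01 l).
have := pmf_ge0 (n - u) l (k - u); have := pmf_ge0 m k l; rewrite /term; nra.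
Qed.

Let term_le2 b : binom_pmf (n - u) (1 - q ^ l) (k - u) <= b -> term <= b.
Proof.
have := @binom_pmf_le1 m (1 - q ^ k) l (qpow01 k).
have := pmf_ge0 (n - u) l (k - u); have := pmf_ge0 m k l; rewrite /term; nra.
Qed.

Let hx := reach_map beta gamma x.
Let hxE : hx = 1 - exp (- (gamma * beta * A)).
Proof. by rewrite /hx /reach_map /aux_frac -/A Rmult_assoc. Qed.

Let A_ge0 : 0 <= A.
Proof. by apply: one_sub_exp_ge0; have := x01; nra. Qed.

(** Either [l] is well below its mean, or the second binomial law has a mean well above [k]. The
    four factors [1 - eps] pay for the rounding in [m], the deviation of [l], the loss of [u]
    vertices and the deviation of [k]. *)
Lemma decay_lower : (1 + eta) * x <= hx -> INR u <= eps * INR n -> (u <= n)%N ->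
  term <= exp (- (eps ^ 2 / 4 * Rmin c1 1 * INR k)).
Proof.
move=> hlow ule un; have e1 : 0 < eps <= 1 by have := eps01; lra.
have r1 := Rmin_l c1 1; have r2 := Rmin_r c1 1.
have e4 : 0 <= eps ^ 2 / 4 by nra.
case: (Rle_lt_dec (INR l) ((1 - eps) * (INR m * (1 - q ^ k)))) => hl.
  apply: term_le1.
  have M0 : 0 <= INR m * (1 - q ^ k).
    by apply: Rmult_le_pos; [exact: pos_INR|case: (qpow01 k)].
  apply: Rle_trans (chernoff_lower (qpow01 k) e1 M0 (Rle_refl _) hl) _.
  apply: exp_le; apply: Ropp_le_contravar; rewrite Rmult_assoc.
  apply: Rmult_le_compat_l => //; apply: Rle_trans mean_lin.
  by apply: Rmult_le_compat_r => //; lra.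
apply: term_le2.
set M := (1 - eps) ^ 3 * (1 + eta) * INR k.
have l_ge : (1 - eps) ^ 2 * (beta * INR n) * A <= INR l.
  apply: Rle_trans (Rlt_le _ _ hl).
  have : (1 - eps) * (beta * INR n) * A <= INR m * (1 - q ^ k).
    apply: Rmult_le_compat => //; last by have := m_bounds; lra.
    by have bn : 0 < beta * INR n by [nra]; have := eps01; nra.
  move=> /(Rmult_le_compat_l (1 - eps)); lra.
have pi_ge : (1 - eps) ^ 2 * ((1 + eta) * x) <= 1 - q ^ l.
  have s : (1 - eps) ^ 2 * (1 - exp (- (gamma * beta * A))) <=
      1 - exp (- ((1 - eps) ^ 2 * (gamma * beta * A))).
    by apply: exp_scale_le; [have := eps01; nra|do 2?apply: Rmult_le_pos; nra].
  have t : (1 - eps) ^ 2 * (gamma * beta * A) <= gamma / INR n * INR l.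
    have -> : (1 - eps) ^ 2 * (gamma * beta * A) =
        gamma / INR n * ((1 - eps) ^ 2 * (beta * INR n) * A) by field; lra.
    by apply: Rmult_le_compat_l l_ge; have := y_gt0; lra.
  have := one_sub_exp_mono t; have := qpow_le l; rewrite -hxE in s.
  have : (1 - eps) ^ 2 * ((1 + eta) * x) <= (1 - eps) ^ 2 * hx.
    by apply: Rmult_le_compat_l hlow; nra.
  lra.
have nu : (1 - eps) * INR n <= INR (n - u) by rewrite minus_INR; [lra|apply/ssrnat.leP].
have M_le : M <= INR (n - u) * (1 - q ^ l).
  have -> : M = (1 - eps) * INR n * ((1 - eps) ^ 2 * ((1 + eta) * x)) by rewrite /M kE; ring.
  apply: Rmult_le_compat nu pi_ge; have := eps01; have := x01; have := eta01 => *; first nra.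
  by do 2?apply: Rmult_le_pos; nra.
have kM : INR k <= (1 - eps) * M.
  have -> : (1 - eps) * M = ((1 - eps) ^ 4 * (1 + eta)) * INR k by rewrite /M; ring.
  suff : 1 <= (1 - eps) ^ 4 * (1 + eta) by nra.
  have h4 : 1 - 4 * eps <= (1 - eps) ^ 4 by have := eps01; nra.
  have eE : eta = 16 * eps by rewrite /eps; lra.
  by rewrite eE; have := eps01; nra.
have kM' : INR k <= M by have := eps01; nra.
have M0 : 0 <= M by lra.
have ku : INR (k - u) <= (1 - eps) * M.
  by apply: Rle_trans kM; apply: le_INR; apply/ssrnat.leP; apply: leq_subr.
apply: Rle_trans (chernoff_lower (qpow01 l) e1 M0 M_le ku) _.
apply: exp_le; apply: Ropp_le_contravar; rewrite Rmult_assoc.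
apply: Rmult_le_compat_l => //.
by have : Rmin c1 1 * INR k <= 1 * INR k by [apply: Rmult_le_compat_r; lra]; lra.
Qed.

(** The four factors [1 + eps] pay for the deviation of [l], the replacement of [q ^ k] and of
    [q ^ l] by exponentials, and the deviation of [k - u]; the spare [1 - eps] absorbs [u]. The rate
    is half the Chernoff rate, as [k - u] is only compared with [k / 2]. *)
Lemma decay_upper : hx <= (1 - eta) * x -> INR u <= eps * INR k -> (u <= n)%N ->
  term <= exp (- (eps ^ 2 / 24 * Rmin c1 1 * INR k)).
Proof.
move=> hupp ule un; have e1 : 0 < eps <= 1 by have := eps01; lra.
have r0 : 0 <= Rmin c1 1 by apply: Rmin_glb; [have := c1_gt0|]; lra.
have r1 := Rmin_l c1 1; have r2 := Rmin_r c1 1.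
have e4 : 0 <= eps ^ 2 / 12 by nra.
have uk : (u <= k)%N by apply/ssrnat.leP/INR_le; nra.
set M' := INR m * (1 - q ^ k).
case: (Rle_lt_dec ((1 + eps) * M') (INR l)) => hl.
  apply: term_le1.
  apply: Rle_trans (chernoff_upper (qpow01 k) e1 (Rle_refl _) hl) _.
  apply: exp_le; apply: Ropp_le_contravar.
  have ml := mean_lin; rewrite -/M' in ml.
  have k1 : c1 * INR k <= INR l.
    have := c1_gt0; have := eps01 => *; have : 0 <= M' by nra.
    nra.
  have : Rmin c1 1 * INR k <= INR l.
    by apply: Rle_trans k1; apply: Rmult_le_compat_r => //; lra.
  move=> /(Rmult_le_compat_l (eps ^ 2 / 12) _ _ e4) h.
  have : 0 <= eps ^ 2 * (Rmin c1 1 * INR k) by apply: Rmult_le_pos; nra.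
  lra.
apply: term_le2.
set M := (1 + eps) ^ 3 * (1 - eta) * INR k.
have l_le : INR l <= (1 + eps) ^ 2 * (beta * INR n) * A.
  apply: Rle_trans (Rlt_le _ _ hl) _.
  have : M' <= beta * INR n * ((1 + eps) * A).
    by apply: Rmult_le_compat; [exact: pos_INR|case: (qpow01 k)|case: m_bounds|exact: A_ge].
  move=> /(Rmult_le_compat_l (1 + eps)); lra.
have gA : 0 <= gamma * beta * A by do 2?apply: Rmult_le_pos; nra.
have pi_le : 1 - q ^ l <= (1 + eps) ^ 3 * ((1 - eta) * x).
  have s : 1 - exp (- ((1 + eps) ^ 3 * (gamma * beta * A))) <=
      (1 + eps) ^ 3 * (1 - exp (- (gamma * beta * A))).
    by apply: exp_scale_ge => //; have := eps01; nra.
  have t : (1 + eps) * (gamma / INR n * INR l) <= (1 + eps) ^ 3 * (gamma * beta * A).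
    have -> : (1 + eps) ^ 3 * (gamma * beta * A) =
        (1 + eps) * (gamma / INR n * ((1 + eps) ^ 2 * (beta * INR n) * A)) by field; lra.
    by do 2![apply: Rmult_le_compat_l; first by have := y_gt0; lra].
  have := one_sub_exp_mono t; have := qpow_ge l; rewrite -hxE in s.
  have : (1 + eps) ^ 3 * hx <= (1 + eps) ^ 3 * ((1 - eta) * x).
    by apply: Rmult_le_compat_l hupp; apply: pow_le; lra.
  lra.
have nu : INR (n - u) <= INR n by apply: le_INR; apply/ssrnat.leP; apply: leq_subr.
have M_ge : INR (n - u) * (1 - q ^ l) <= M.
  have -> : M = INR n * ((1 + eps) ^ 3 * ((1 - eta) * x)) by rewrite /M kE; ring.
  by apply: Rmult_le_compat nu pi_le; [exact: pos_INR|case: (qpow01 l)].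
have kuE : INR (k - u) = INR k - INR u by rewrite minus_INR //; apply/ssrnat.leP.
have kM : (1 + eps) * M <= INR (k - u).
  have -> : (1 + eps) * M = ((1 + eps) ^ 4 * (1 - eta)) * INR k by rewrite /M; ring.
  suff : (1 + eps) ^ 4 * (1 - eta) <= 1 - eps by rewrite kuE; nra.
  have h4 : (1 + eps) ^ 4 <= 1 + 15 * eps.
    have e2 : eps * eps <= eps by have := eps01; nra.
    have e3 : eps * (eps * eps) <= eps by have := eps01; nra.
    have e5 : eps * (eps * (eps * eps)) <= eps by have := eps01; nra.
    have -> : (1 + eps) ^ 4 = 1 + 4 * eps + 6 * (eps * eps) + 4 * (eps * (eps * eps)) +
      eps * (eps * (eps * eps)) by ring.
    lra.
  have eE : eta = 16 * eps by rewrite /eps; lra.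
  by rewrite eE; have := eps01; nra.
apply: Rle_trans (chernoff_upper (qpow01 l) e1 M_ge kM) _.
apply: exp_le; apply: Ropp_le_contravar; rewrite kuE.
have ku2 : Rmin c1 1 * INR k / 2 <= INR k - INR u.
  have : Rmin c1 1 * INR k <= 1 * INR k by apply: Rmult_le_compat_r; lra.
  have := eps01; nra.
have := Rmult_le_compat_l (eps ^ 2 / 12) _ _ e4 ku2; lra.
Qed.

End Decay.

(** * Probabilities and components in the random intersection graph *)

Lemma RlebP x y : reflect (x <= y) (Rleb x y).
Proof. by rewrite /Rleb; case: Rle_dec => h; constructor. Qed.

Section Prob.
Variables (n m : nat) (p : R).
Hypothesis p01 : 0 <= p <= 1.
Implicit Types E F : pred (bipartite n m).

Lemma bip_weightE (B : bipartite n m) : bip_weight p B = weight p B.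
Proof.
rewrite /bip_weight /weight (bigID (mem B)) /= RpowE RpowE.
congr (Rmult _ _).
  by rewrite -prodr_const; apply: eq_bigr => e ->.
have <- : #|~: B| = (n * m - #|B|)%N by rewrite cardsCs setCK card_prod !card_ord.
rewrite -prodr_const; apply: eq_big => e; first by rewrite inE.
by rewrite inE => /negbTE ->.
Qed.

Lemma prob_expect E : prob p E = expect p (fun B => (E B)%:R%Rg).
Proof.
rewrite /prob /expect big_mkcond; apply: eq_bigr => B _; rewrite bip_weightE.
by case: (E B); rewrite ?mulr1 ?mulr0.
Qed.

Let p_ge0 : (0 <= p)%Rg. Proof. by apply/RleP; case: p01. Qed.
Let p_le1 : (p <= 1)%Rg. Proof. by apply/RleP; case: p01. Qed.

Lemma prob_sub E F : (forall B, E B -> F B) -> prob p E <= prob p F.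
Proof.
move=> EF; rewrite !prob_expect; apply/RleP; apply: ler_expect => // B.
by rewrite ler_nat; case: (E B) (EF B) => // ->.
Qed.

Lemma prob_le1 E : prob p E <= 1.
Proof.
apply: Rle_trans (@prob_sub E xpredT _) _ => //; rewrite prob_expect.
by apply: Req_le; apply: expect_cst.
Qed.

Lemma prob_predC E : prob p E = 1 - prob p (predC E).
Proof.
suff : prob p E + prob p (predC E) = 1 by lra.
rewrite !prob_expect -[RHS](expect_cst ('I_n * 'I_m)%type p) /expect RplusE -big_split.
apply: eq_bigr => B _ /=; rewrite -mulrDr; congr (_ * _)%Rg.
by case: (E B); rewrite ?addr0 ?add0r.
Qed.

Lemma prob_union (I : finType) (E : I -> pred (bipartite n m)) F b :
    (forall B, F B -> exists i, E i B) -> (forall i, prob p (E i) <= b) ->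
  prob p F <= INR #|I| * b.
Proof.
move=> FE Eb; apply: (@Rle_trans _ (\sum_(i : I) prob p (E i))%Rg).
  under eq_bigr => i _ do rewrite prob_expect.
  rewrite prob_expect /expect exchange_big; apply/RleP; apply: ler_sum => B _.
  rewrite -mulr_sumr; apply: ler_wpM2l; first exact: weight_ge0.
  case: (boolP (F B)) => [/FE[i Ei]|_]; last exact: sumr_ge0.
  by rewrite (bigD1 i) //= Ei lerDl sumr_ge0.
rewrite INRE; apply/RleP; rewrite RmultE mulr_natl -sumr_const.
by apply: ler_sum => i _; apply/RleP.
Qed.

Definition hit_event (U : {set 'I_n}) k : pred (bipartite n m) :=
  fun B => #|reach U B| == k.

(** Union bound over the index and the [n + 1] possible sizes; a pair outside [Q] contributes an
    empty event, whence [0 <= b]. *)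
Lemma reach_union (I : finType) (U : I -> {set 'I_n}) (Q : I -> pred nat) b : 0 <= b ->
    (forall i k, (k <= n)%N -> Q i k -> prob p (hit_event (U i) k) <= b) ->
  prob p (fun B : bipartite n m => [exists i, Q i #|reach (U i) B|]) <= INR #|I| * (INR n.+1 * b).
Proof.
move=> b0 Qb; rewrite -Rmult_assoc -mult_INR.
have -> : (#|I| * n.+1)%coq_nat = #|{: I * 'I_n.+1}| by rewrite card_prod card_ord.
apply: (@prob_union (I * 'I_n.+1)%type (fun z B => Q z.1 z.2 && hit_event (U z.1) z.2 B)).
  move=> B /existsP[i Qi]; have kn : (#|reach (U i) B| < n.+1)%N.
    by rewrite ltnS -[X in (_ <= X)%N](card_ord n) max_card.
  by exists (i, Ordinal kn); rewrite /= /hit_event Qi eqxx.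
move=> [i k] /=; case: (boolP (Q i k)) => Qik.
  apply: Rle_trans (Qb i k _ Qik); last by rewrite -ltnS.
  by apply: prob_sub => B /andP[].
apply: Rle_trans b0; rewrite prob_expect; apply: Req_le.
rewrite -[RHS](expect_cst ('I_n * 'I_m)%type p); exact: eq_expect.
Qed.

End Prob.

Section Reach.
Variables (n m : nat) (B : bipartite n m).

Lemma rig_adj_sym : symmetric (rig_adj B).
Proof.
move=> i j; rewrite /rig_adj eq_sym; congr (_ && _); apply: eq_existsb => k; exact: andbC.
Qed.

Lemma reachE (U : {set 'I_n}) :
  reach U B = [set w | [exists u in U, connect (rig_adj B) u w]].
Proof.
have step := cluster_step (ed := @bip_edge n m).
apply/setP => w; rewrite [w \in reach U B]inE [RHS]inE; apply/idP/exists_inP.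
  (* Invariant along bipartite paths: an auxiliary vertex counts as reached when it is joined to a
     vertex reachable in the intersection graph. *)
  pose P (x : 'I_n + 'I_m) := match x with
    | inl i => [exists u in U, connect (rig_adj B) u i]
    | inr k => [exists u in U, [exists i, connect (rig_adj B) u i && ((i, k) \in B)]]
    end.
  move=> wC; apply/exists_inP; rewrite -/(P (inl w)); move: wC.
  apply: (@cluster_min _ _ _ _ _ _ P) => [[i|k]|[i|k] [j|l]] //; rewrite ?inE //= /adj /=.
  - by move=> iU; apply/exists_inP; exists i.
  - move=> /exists_inP[u uU ui] il _; apply/exists_inP; exists u => //.
    by apply/existsP; exists i; rewrite ui.
  - move=> /exists_inP[u uU /existsP[i /andP[ui ik]]] jk _; apply/exists_inP; exists u => //.
    have [<- //|ij] := eqVneq i j.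
    apply: connect_trans ui (connect1 _); rewrite /rig_adj ij /=.
    by apply/existsP; exists k; rewrite ik.
move=> [u uU /connectP[s sp ->]].
have : inl u \in cluster (@bip_edge n m) B setT (bip_set U set0).
  by apply: (subsetP (sub_cluster _ _ _ _)); rewrite inE.
elim: s u {uU} sp => //= j s IH u /andP[/andP[_ /existsP[k /andP[uk jk]]] sp] uC.
apply: IH sp _; have kC := step _ _ _ _ _ uC (_ : adj _ _ _ (inr k)) (in_setT _).
by apply: (step _ _ _ _ _ (kC uk) _ (in_setT _)).
Qed.

Lemma comp_sizeE (v : 'I_n) : comp_size B v = #|reach [set v] B|.
Proof.
rewrite reachE /comp_size; apply: eq_card => w; rewrite !inE.
apply/idP/exists_inP => [vw|[u]]; first by exists v; rewrite ?inE.
by rewrite inE => /eqP ->.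
Qed.

Lemma card_reach_le (U : {set 'I_n}) : (#|reach U B| <= \sum_(u in U) comp_size B u)%N.
Proof.
have -> : reach U B = \bigcup_(u in U) [set w | connect (rig_adj B) u w].
  rewrite reachE; apply/setP => w; rewrite inE; apply/exists_inP/bigcupP => -[u uU uw].
    by exists u; rewrite ?inE.
  by exists u; rewrite // inE in uw.
elim/big_rec2 : _ => [|u a b _ ab]; first by rewrite cards0.
by apply: leq_trans (leq_card_setU _ _) _; rewrite leq_add2l.
Qed.

Lemma reach_pair (v w : 'I_n) : ~~ connect (rig_adj B) v w ->
  #|reach [set v; w] B| = (comp_size B v + comp_size B w)%N.
Proof.
move=> vw; have csym := sym_connect_sym rig_adj_sym.
have -> : reach [set v; w] B =
    [set x | connect (rig_adj B) v x] :|: [set x | connect (rig_adj B) w x].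
  rewrite reachE; apply/setP => x; rewrite !inE; apply/exists_inP/orP.
    by move=> [u]; rewrite !inE => /orP[/eqP ->|/eqP ->]; [left|right].
  by move=> [h|h]; [exists v|exists w]; rewrite ?inE ?eqxx ?orbT.
rewrite cardsU; set I := _ :&: _; have -> : I = set0; last by rewrite cards0 subn0.
apply/setP => x; rewrite !inE; apply: contraNF vw => /andP[vx wx].
by apply: connect_trans vx _; rewrite csym.
Qed.

End Reach.

(** * Asymptotics *)

Definition eventually (P : nat -> Prop) := exists N, forall n, (N <= n)%N -> P n.

Lemma eventually_and P Q : eventually P -> eventually Q -> eventually (fun n => P n /\ Q n).
Proof.
move=> [N NP] [M MQ]; exists (maxn N M) => n; rewrite geq_max => /andP[Nn Mn].
by split; [exact: NP|exact: MQ].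
Qed.

Lemma eventually_mono (P Q : nat -> Prop) :
  (forall n, P n -> Q n) -> eventually P -> eventually Q.
Proof. by move=> PQ [N NP]; exists N => n /NP/PQ. Qed.

Lemma eventually_ge A : eventually (fun n => A <= INR n).
Proof.
have [N AN] := INR_unbounded A; exists N => n Nn.
by have : INR N <= INR n by [apply: le_INR; apply/ssrnat.leP]; lra.
Qed.

Lemma eventually_ln_ge A : eventually (fun n => A <= ln (INR n)).
Proof.
apply: eventually_mono (eventually_ge (exp A)) => n An.
have := exp_pos A; case: An => [An|<-]; last by rewrite ln_exp; lra.
by move=> e0; left; rewrite -{1}(ln_exp A); apply: ln_increasing.
Qed.

(** Ensures that about K log n components of fewer than K log n vertices cover only o(n) vertices.
    With [s] the fourth root of [n], [ln s <= s] bounds the square by a multiple of [sqrt n]. *)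
Lemma eventually_ln_sq K a : 0 < K -> 0 < a ->
  eventually (fun n => (K * ln (INR n) + 1) * (K * ln (INR n) + 1) <= a * INR n).
Proof.
move=> K0 a0; pose C := (4 * K + 1) * (4 * K + 1) / a.
apply: eventually_mono (eventually_and (eventually_ge 1) (eventually_ge (C * C))) => n [n1 nC].
set r := sqrt (INR n); set s := sqrt r.
have r1 : 1 <= r by rewrite -sqrt_1; apply: sqrt_le_1_alt.
have s1 : 1 <= s by rewrite -sqrt_1; apply: sqrt_le_1_alt.
have rE : r * r = INR n by apply: sqrt_sqrt; lra.
have sE : s * s = r by apply: sqrt_sqrt; lra.
have lnE : ln (INR n) = 4 * ln s.
  by rewrite -rE -sE !ln_mult; try nra.
have lns : ln s <= s.
  by have := exp_ineq1_le (ln s); rewrite exp_ln; lra.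
have lns0 : 0 <= ln s.
  by case: s1 => [s1|<-]; rewrite ?ln_1; [left; rewrite -ln_1; apply: ln_increasing; lra|lra].
have h : K * ln (INR n) + 1 <= (4 * K + 1) * s by rewrite lnE; nra.
have h0 : 0 <= K * ln (INR n) + 1 by rewrite lnE; nra.
have Cr : C <= r.
  have C0 : 0 <= C by apply: Rmult_le_pos; [nra|left; apply: Rinv_0_lt_compat].
  by rewrite -(sqrt_square C) //; apply: sqrt_le_1_alt.
have aC : (4 * K + 1) * (4 * K + 1) = a * C by rewrite /C; field; lra.
apply: (@Rle_trans _ (((4 * K + 1) * s) * ((4 * K + 1) * s))); first by apply: Rmult_le_compat.
have -> : (4 * K + 1) * s * ((4 * K + 1) * s) = a * C * r by rewrite -aC -sE; ring.
have ar : 0 <= a * r by nra.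
by rewrite -rE; have := Rmult_le_compat_l _ _ _ ar Cr; lra.
Qed.

Lemma Un_cv_of_rate (u : nat -> R) C :
  eventually (fun n => 1 - C / INR n <= u n <= 1) -> Un_cv u 1.
Proof.
move=> uC eps eps0.
have [N h] := eventually_and uC (eventually_and (eventually_ge 1) (eventually_ge (C / eps + 1))).
exists N => n /ssrnat.leP/h [[u1 u2] [n1 nC]].
have Cn : C / INR n < eps.
  apply: (Rmult_lt_reg_r (INR n)); first lra.
  have -> : C / INR n * INR n = C by field; lra.
  have -> : C = eps * (C / eps) by field; lra.
  by apply: Rmult_lt_compat_l; lra.
by rewrite /Rdist /Rabs; case: Rcase_abs; lra.
Qed.

Section Asymptotics.
Variables (beta gamma : R).
Hypotheses (beta_gt0 : 0 < beta) (gamma_gt0 : 0 < gamma).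

Lemma m_of_bounds n : beta * INR n - 1 <= INR (m_of beta n) <= beta * INR n.
Proof.
rewrite /m_of; have n0 := pos_INR n; have [b1 b2] := base_Int_part (beta * INR n).
have bn : 0 <= beta * INR n by nra.
have z0 : Z.le Z0 (Int_part (beta * INR n)).
  have : IZR (-1) < IZR (Int_part (beta * INR n)) by lra.
  by move/lt_IZR; lia.
by rewrite (INR_IZR_INZ (Z.to_nat _)) Z2Nat.id //; lra.
Qed.

(* [x] plays the role of |C(U)| / n: its law is exponentially small where [reach_map] is
   a relative distance eta away from the identity. *)
Definition off_diag eta u n k :=
  let x := INR k / INR n in
  (1 + eta) * x <= reach_map beta gamma x /\ INR u <= eta / 16 * INR n \/
  reach_map beta gamma x <= (1 - eta) * x /\ INR u <= eta / 16 * INR k.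

Lemma reach_size_decay eta : 0 < eta <= 1 ->
  exists2 c, 0 < c & eventually (fun n => 0 <= p_of gamma n <= 1 /\
    forall (U : {set 'I_n}) k, (0 < k)%N -> (k <= n)%N -> off_diag eta #|U| n k ->
      prob (p_of gamma n) (@hit_event n (m_of beta n) U k) <=
      INR (m_of beta n).+1 * exp (- (c * INR k))).
Proof.
move=> eta01; set eps := eta / 16.
have eps01 : 0 < eps <= / 16 by rewrite /eps; lra.
pose c1 := beta * gamma / (2 * (1 + gamma)).
have c1_gt0 : 0 < c1 by apply: Rdiv_lt_0_compat; nra.
have c0 : 0 < Rmin c1 1 by apply: Rmin_glb_lt; lra.
exists (eps ^ 2 / 24 * Rmin c1 1); first by apply: Rmult_lt_0_compat => //; nra.
(* The first threshold provides [n_large]; the second makes the rounding error 1 in [m_of] at most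
   [eps * beta * n]. *)
apply: eventually_mono (eventually_and (eventually_ge (2 * gamma / eps + 1))
  (eventually_ge (/ (eps * beta)))) => n [n1 n2].
have g0 : 0 < 2 * gamma / eps by apply: Rdiv_lt_0_compat; nra.
have n0 : 0 < INR n by lra.
have n_large : gamma / INR n * (1 + eps) <= eps.
  apply: (Rmult_le_reg_r (INR n)) => //.
  have -> : gamma / INR n * (1 + eps) * INR n = gamma * (1 + eps) by field; lra.
  have : eps * (2 * gamma / eps) <= eps * INR n by apply: Rmult_le_compat_l; lra.
  have -> : eps * (2 * gamma / eps) = 2 * gamma by field; lra.
  nra.
have y0 : 0 < gamma / INR n by apply: Rdiv_lt_0_compat.
have m_bounds : (1 - eps) * (beta * INR n) <= INR (m_of beta n) <= beta * INR n.
  have [m1 m2] := m_of_bounds n; split => //.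
  have : eps * beta * / (eps * beta) <= eps * beta * INR n by apply: Rmult_le_compat_l; nra.
  rewrite Rinv_r; nra.
have p01 : 0 <= p_of gamma n <= 1.
  rewrite /p_of; have : 0 <= gamma / INR n * eps by apply: Rmult_le_pos; lra.
  lra.
split=> // U k k1 kn off.
have p0 : (0 <= p_of gamma n)%Rg by apply/RleP; case: p01.
have p1 : (p_of gamma n <= 1)%Rg by apply/RleP; case: p01.
have /RleP law := @reach_size_law_le _ n (m_of beta n) _ p0 p1 U k.
rewrite prob_expect; apply: Rle_trans law _.
rewrite INRE RmultE mulr_natl -[X in (_ *+ X)%Rg]card_ord -sumr_const.
apply/RleP; apply: ler_sum => l _; apply/RleP; rewrite -!RpowE.
have k0 : 0 < INR k by apply: lt_0_INR; apply/ssrnat.ltP.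
have kn' : INR k <= INR n by apply: le_INR; apply/ssrnat.leP.
have Un : (#|U| <= n)%N by rewrite -[X in (_ <= X)%N](card_ord n) max_card.
case: off => -[off Ue].
  have := decay_lower beta_gt0 gamma_gt0 l eta01 n0 k0 kn' n_large m_bounds off Ue Un.
  move=> h; apply: Rle_trans h _; apply: exp_le; apply: Ropp_le_contravar.
  have : 0 <= eps ^ 2 * (Rmin c1 1 * INR k) by apply: Rmult_le_pos; nra.
  rewrite -/eps -/c1; lra.
have h := decay_upper beta_gt0 gamma_gt0 l eta01 n0 k0 kn' n_large m_bounds off Ue Un.
by apply: Rle_trans h _; right.
Qed.

(* K = 6 / c makes each of the at most (n^2 + 1) (n + 1) (m + 1) bad events of probability n^-6. *)
Lemma reach_size_whp eta : 0 < eta <= 1 ->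
  exists2 K, 0 < K & exists C, eventually (fun n => 0 <= p_of gamma n <= 1 /\
    forall (I : finType) (U : I -> {set 'I_n}) (Q : I -> pred nat), (#|I| <= (n * n).+1)%N ->
      (forall i k, (k <= n)%N -> Q i k -> K * ln (INR n) <= INR k /\ off_diag eta #|U i| n k) ->
      rig_prob beta gamma n (fun B => [exists i, Q i #|reach (U i) B|]) <= C / INR n).
Proof.
move=> eta01; have [c c0 decay] := reach_size_decay eta01.
exists (6 / c); first by apply: Rdiv_lt_0_compat; lra.
exists (4 * (beta + 1)).
apply: eventually_mono (eventually_and decay (eventually_and (eventually_ge 1)
  (eventually_ln_ge 1))) => n [[p01 {}decay] [n1 ln1]]; split => // I U Q In Qoff.
set L := 6 / c * ln (INR n) in Qoff.
have L0 : 0 < L by apply: Rmult_lt_0_compat; [apply: Rdiv_lt_0_compat; lra|lra].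
have eL : exp (- (c * L)) * INR n ^ 6 = 1.
  rewrite -(exp_ln (INR n)); last lra.
  rewrite pow_exp -exp_plus -exp_0 /L; congr exp; rewrite /=; field; lra.
have b0 : 0 <= INR (m_of beta n).+1 * exp (- (c * L)).
  by apply: Rmult_le_pos; [exact: pos_INR|left; exact: exp_pos].
apply: Rle_trans (@reach_union n (m_of beta n) (p_of gamma n) p01 I U Q _ b0 _) _.
  move=> i k kn Qik; have [Lk off] := Qoff i k kn Qik.
  have k0 : (0 < k)%N by apply/ssrnat.ltP/INR_lt => /=; lra.
  apply: Rle_trans (decay (U i) k k0 kn off) _.
  apply: Rmult_le_compat_l; first exact: pos_INR.
  by apply: exp_le; apply: Ropp_le_contravar; apply: Rmult_le_compat_l; lra.
have [m0 m1] := m_of_bounds n.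
set e := exp _ in eL *; have e0 : 0 < e by apply: exp_pos.
have In' : INR #|I| <= 2 * (INR n * INR n).
  apply: (@Rle_trans _ (INR (n * n).+1)); first by apply: le_INR; apply/ssrnat.leP.
  by rewrite S_INR mult_INR; nra.
apply: (@Rle_trans _ (2 * (INR n * INR n) * ((2 * INR n) * (((beta + 1) * INR n) * e)))).
  apply: Rmult_le_compat => //; first exact: pos_INR.
    by apply: Rmult_le_pos => //; exact: pos_INR.
  apply: Rmult_le_compat => //; [exact: pos_INR|rewrite S_INR; lra|].
  by apply: Rmult_le_compat_r; [lra|rewrite S_INR; nra].
apply: (Rmult_le_reg_r (INR n)); first lra.
have -> : 4 * (beta + 1) / INR n * INR n = 4 * (beta + 1) by field; lra.
have -> : 2 * (INR n * INR n) * (2 * INR n * ((beta + 1) * INR n * e)) * INR n =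
  4 * (beta + 1) * (e * INR n ^ 5) by ring.
rewrite -{2}(Rmult_1_r (4 * (beta + 1))); apply: Rmult_le_compat_l; first lra.
have n5 : 0 <= e * INR n ^ 5 by apply: Rmult_le_pos; [lra|apply: pow_le; lra].
have : e * INR n ^ 5 * 1 <= e * INR n ^ 5 * INR n by apply: Rmult_le_compat_l; lra.
have -> : e * INR n ^ 5 * INR n = e * INR n ^ 6 by ring.
lra.
Qed.

Lemma rig_prob_compl n C (E F : pred (bipartite n (m_of beta n))) :
  0 <= p_of gamma n <= 1 -> (forall B, ~~ E B -> F B) ->
  rig_prob beta gamma n F <= C / INR n ->
  1 - C / INR n <= rig_prob beta gamma n E <= 1.
Proof.
move=> p01 EF FC; split; last exact: prob_le1.
have := @prob_sub _ _ _ p01 (predC E) F EF.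
rewrite /rig_prob in FC *; rewrite (prob_predC (p_of gamma n) E); lra.
Qed.

(** Since h(x) <= mu x, the relative gap [1 - mu] is available at every size, and singletons suffice
    as sources. *)
Lemma subcritical : beta * gamma ^ 2 < 1 ->
  exists K : R,
    Un_cv (fun n => rig_prob beta gamma n
             (fun B => [forall v, Rleb (INR (comp_size B v)) (K * ln (INR n))]))
          1.
Proof.
move=> mu1; set eta := 1 - beta * gamma ^ 2.
have mu0 : 0 < beta * gamma ^ 2 by apply: Rmult_lt_0_compat => //; apply: pow_lt.
have eta01 : 0 < eta <= 1 by rewrite /eta; lra.
have [K K0 [C whp]] := reach_size_whp eta01.
exists K; apply: (@Un_cv_of_rate _ C).
(* The bound on [ln n] makes 1, the size of a singleton source, at most [eta / 16] times [K * ln n],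
   as [off_diag] demands. *)
apply: eventually_mono (eventually_and whp (eventually_and (eventually_ge 1)
  (eventually_ln_ge (16 / (eta * K))))) => n [[p01 {}whp] [n1 ln1]].
apply: (rig_prob_compl p01 _ (whp 'I_n (fun v => [set v])
  (fun _ k => ~~ Rleb (INR k) (K * ln (INR n))) _ _)).
- by move=> B /forallPn[v hv]; apply/existsP; exists v; rewrite -comp_sizeE.
- by rewrite card_ord; nia.
move=> v k kn /RlebP/Rnot_le_lt Lk; split; first lra.
right; split.
  apply: Rle_trans (reach_map_le beta_gt0 gamma_gt0 _) _; last by rewrite /eta; lra.
  by apply: Rmult_le_pos; [exact: pos_INR|left; apply: Rinv_0_lt_compat; lra].
rewrite cards1 /=.
have : eta / 16 * K * (16 / (eta * K)) <= eta / 16 * K * ln (INR n).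
  by apply: Rmult_le_compat_l ln1; apply: Rmult_le_pos; lra.
have -> : eta / 16 * K * (16 / (eta * K)) = 1 by field; lra.
have : eta / 16 * (K * ln (INR n)) <= eta / 16 * INR k by apply: Rmult_le_compat_l; lra.
lra.
Qed.

End Asymptotics.

(** * Deterministic step: from the size dichotomy to a unique giant component *)

Section Giant.
Variables (n m : nat) (B : bipartite n m) (L x0 delta : R) (U0 : {set 'I_n}).
Hypotheses (n_gt0 : 0 < INR n) (L_ge0 : 0 <= L) (delta_x0 : 3 * delta <= x0).

Definition giant_size (s : nat) := Rabs (INR s / INR n - x0) < delta.

Hypothesis pair_dichotomy : forall v w : 'I_n,
  INR #|reach [set v; w] B| < L \/ giant_size #|reach [set v; w] B|.
Hypothesis seed_giant : giant_size #|reach U0 B|.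
Hypothesis seed_small : INR #|U0| * L < (x0 - delta) * INR n.
Hypothesis L_small : L < (x0 - delta) * INR n.

Lemma giant_sizeP s : giant_size s <-> (x0 - delta) * INR n < INR s < (x0 + delta) * INR n.
Proof.
have sE : INR s = INR s / INR n * INR n by field; lra.
rewrite sE /giant_size; set y := INR s / INR n.
split=> [/Rabs_def2 [h1 h2]|[h1 h2]].
  by split; apply: Rmult_lt_compat_r; lra.
by apply: Rabs_def1; apply: (Rmult_lt_reg_r (INR n)) => //; lra.
Qed.

(** A pair with equal entries is a single component. *)
Lemma comp_dichotomy (v : 'I_n) : INR (comp_size B v) < L \/ giant_size (comp_size B v).
Proof. by have := pair_dichotomy v v; rewrite setUid -comp_sizeE. Qed.

(** Otherwise all components meeting the seed are small and cover at most [#|U0| * L] vertices, too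
    few for [seed_giant]. *)
Lemma giant_exists : exists v : 'I_n, giant_size (comp_size B v).
Proof.
have [[v Lv]|all_small] : (exists v, L <= INR (comp_size B v)) \/
    (forall v, v \in U0 -> INR (comp_size B v) < L).
  case: (pickP (fun v => (v \in U0) && Rleb L (INR (comp_size B v)))) => [v|none].
    by move=> /andP[vU /RlebP Lv]; left; exists v.
  right=> v vU; have := none v; rewrite vU /= => /RlebP; lra.
- by exists v; case: (comp_dichotomy v) => //; lra.
- have /giant_sizeP [big _] := seed_giant; exfalso.
  have : INR #|reach U0 B| <= INR #|U0| * L.
    apply: (@Rle_trans _ (INR (\sum_(u in U0) comp_size B u))).
      by apply: le_INR; apply/ssrnat.leP; apply: card_reach_le.
    have -> : INR #|U0| * L = (\sum_(u in U0) L)%Rg by rewrite sumr_const INRE RmultE mulr_natl.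
    rewrite INRE natr_sum; apply/RleP; apply: ler_sum => u uU.
    by rewrite -INRE; apply/RleP; left; apply: all_small.
  lra.
Qed.

(** Two giant components would have together more than [2 * (x0 - delta) * n] vertices, hence more
    than [(x0 + delta) * n] because [3 * delta <= x0], and more than [L]: the pair would violate the
    dichotomy. *)
Lemma giant_unique (v w : 'I_n) : giant_size (comp_size B v) ->
  ~~ connect (rig_adj B) v w -> INR (comp_size B w) < L.
Proof.
move=> /giant_sizeP[v1 v2] vw; case: (comp_dichotomy w) => // /giant_sizeP[w1 w2].
have := pair_dichotomy v w; rewrite reach_pair // plus_INR => -[|/giant_sizeP]; first lra.
rewrite plus_INR; nra.
Qed.

Lemma largest_giant : giant_size (largest_comp B).
Proof.
have [v vg] := giant_exists.
have n0 : (0 < #|'I_n|)%N by apply/card_gt0P; exists v.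
have [w wE] := bigop.eq_bigmax (comp_size B) n0; rewrite /largest_comp wE.
have vw : (comp_size B v <= comp_size B w)%N by rewrite -wE bigop.leq_bigmax.
case: (comp_dichotomy w) => // wL; move/giant_sizeP: vg => [v1 _].
have : INR (comp_size B v) <= INR (comp_size B w) by apply: le_INR; apply/ssrnat.leP.
lra.
Qed.

End Giant.

(** * Existence of the giant component with high probability *)

Section Supercritical.
Variables (beta gamma x0 : R).
Hypotheses (beta_gt0 : 0 < beta) (gamma_gt0 : 0 < gamma).
Hypotheses (x01 : 0 < x0 < 1) (x0_fix : reach_map beta gamma x0 = x0).

(** The event [E] is arbitrary so that one estimate serves both the size of the largest component
    and the bound on the others. *)
Lemma giant_whp delta : 0 < delta -> 3 * delta <= x0 ->
  exists K C, eventually (fun n => forall E : pred (bipartite n (m_of beta n)),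
    (forall B, (exists2 v, giant_size n x0 delta (comp_size B v) &
                  forall w, ~~ connect (rig_adj B) v w ->
                    INR (comp_size B w) <= K * ln (INR n)) ->
               giant_size n x0 delta (largest_comp B) -> E B) ->
    1 - C / INR n <= rig_prob beta gamma n E <= 1).
Proof.
move=> d0 dx0; have x0_gt0 : 0 < x0 by lra.
have [eta eta01 gap] := reach_map_gap beta_gt0 gamma_gt0 x0_gt0 x0_fix d0.
have [K K0 [C whp]] := reach_size_whp beta_gt0 gamma_gt0 eta01.
(* The first term keeps a source set below [eta / 16 * k] when [x0 <= k / n]; the second keeps the
   small components meeting the seed below giant size. *)
exists K, C; pose a := Rmin (eta / 16 * x0) (x0 - delta).
have a0 : 0 < a by apply: Rmin_glb_lt; [apply: Rmult_lt_0_compat|]; lra.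
have a1 : a <= eta / 16 * x0 by apply: Rmin_l.
have a2 : a <= x0 - delta by apply: Rmin_r.
apply: eventually_mono (eventually_and whp (eventually_and (eventually_ge 1)
  (eventually_and (eventually_ln_ge (/ K)) (eventually_ln_sq K0 a0))))
  => n [[p01 {}whp] [n1 [ln1 lnsq]]] E EP.
set L := K * ln (INR n) in whp lnsq EP.
have L1 : 1 <= L.
  have -> : 1 = K * / K by field; lra.
  by apply: Rmult_le_compat_l; lra.
have an : L + 1 <= a * INR n by nra.
(* A seed with at least [L] vertices cannot reach fewer than [L], which leaves only the giant
   alternative for it. *)
have [u0 [u1 u2]] : exists u0, L <= INR u0 <= L + 1.
  have [h1 h2] := archimed L; exists (Z.to_nat (up L)).
  have z0 : Z.le Z0 (up L) by apply: le_IZR; lra.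
  by rewrite INR_IZR_INZ Z2Nat.id //; lra.
have u0n : (u0 <= n)%N.
  apply/ssrnat.leP/INR_le; have : eta / 16 * x0 <= 1 by nra.
  nra.
have [U0 U0E] : exists U0 : {set 'I_n}, #|U0| = u0.
  have : (0 < #|[set A : {set 'I_n} | #|A| == u0]|)%N by rewrite card_draws card_ord bin_gt0.
  by move=> /card_gt0P[A]; rewrite inE => /eqP AE; exists A.
(* All ordered pairs, and [None] for the seed: [n * n + 1] source sets in a single union bound. *)
pose U (i : option ('I_n * 'I_n)) := if i is Some (v, w) then [set v; w] else U0.
pose Q k := Rleb L (INR k) && Rleb delta (Rabs (INR k / INR n - x0)).
apply: (rig_prob_compl p01 _ (whp _ U (fun=> Q) _ _)); first last.
- move=> i k kn /andP[/RlebP Lk /RlebP dk]; split=> //.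
  have Ui : INR #|U i| <= a * INR n.
    apply: Rle_trans an; case: i => [[v w]|]; last by rewrite /= U0E.
    apply: (@Rle_trans _ (INR 2)); last by rewrite /=; lra.
    apply: le_INR; apply/ssrnat.leP; rewrite /= cards2; by case: eqP.
  have xk : 0 < INR k / INR n by apply: Rdiv_lt_0_compat; lra.
  case: (gap _ xk dk) => [low|[x0k upp]]; [left|right]; split=> //.
    apply: Rle_trans Ui _; apply: Rmult_le_compat_r; first lra.
    by apply: Rle_trans a1 _; nra.
  apply: Rle_trans Ui _; apply: (@Rle_trans _ (eta / 16 * x0 * INR n)).
    by apply: Rmult_le_compat_r; lra.
  rewrite Rmult_assoc; apply: Rmult_le_compat_l; first lra.
  have -> : INR k = INR k / INR n * INR n by field; lra.
  by apply: Rmult_le_compat_r; lra.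
- by rewrite card_option card_prod card_ord.
move=> B; apply: contraR => /existsPn nQ.
have dich s : ~~ Q s -> INR s < L \/ giant_size n x0 delta s.
  rewrite negb_and => /orP[/RlebP|/RlebP] h; first by left; lra.
  by right; rewrite /giant_size; lra.
have pairs v w := dich _ (nQ (Some (v, w))).
have seed : giant_size n x0 delta #|reach U0 B|.
  case: (dich _ (nQ None)) => //; rewrite [U None]/= => small.
  have : INR #|U0| <= INR #|reach U0 B|.
    by apply: le_INR; apply/ssrnat.leP; apply: subset_leq_card (sub_reach _ _).
  rewrite U0E; lra.
have n0 : 0 < INR n by lra.
have L0 : 0 <= L by lra.
have xn : a * INR n <= (x0 - delta) * INR n by apply: Rmult_le_compat_r; lra.
have seed_small : INR #|U0| * L < (x0 - delta) * INR n by rewrite U0E; nra.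
have L_small : L < (x0 - delta) * INR n by lra.
have [v vg] := giant_exists n0 pairs seed seed_small.
apply: EP; last exact: largest_giant n0 pairs seed seed_small L_small.
by exists v => // w vw; left; apply: giant_unique n0 L0 dx0 pairs L_small v w vg vw.
Qed.

End Supercritical.

Theorem theorem1 (beta gamma : R) (hbeta : (0 < beta)%R) (hgamma : (0 < gamma)%R) :
  (* (i) subcritical case *)
  ((beta * gamma ^ 2 < 1)%R ->
     exists K : R,
       Un_cv (fun n => rig_prob beta gamma n
                (fun B => [forall v, Rleb (INR (comp_size B v)) (K * ln (INR n))%R]))
             1%R)
  /\
  (* (ii) supercritical case *)
  ((1 < beta * gamma ^ 2)%R ->
     (exists rho, smallest_fixpoint beta gamma rho) /\
     forall rho, smallest_fixpoint beta gamma rho ->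
       (0 < rho < 1)%R
       /\ (forall eps : R, (0 < eps)%R ->
             Un_cv (fun n => rig_prob beta gamma n
                      (fun B => Rleb (Rabs (INR (largest_comp B) / INR n - (1 - rho))) eps))
                   1%R)
       /\ (exists K : R,
             Un_cv (fun n => rig_prob beta gamma n
                      (fun B => [exists v, forall w,
                                  ~~ connect (rig_adj B) v w ==>
                                  Rleb (INR (comp_size B w)) (K * ln (INR n))%R]))
                   1%R)).
Proof.
split; first exact: subcritical.
move=> mu1; split.
  have [x x01 hx] := reach_map_fixpoint hbeta hgamma mu1.
  exists (1 - x); apply/(smallest_fixpointP hbeta hgamma _ mu1).
  by have -> : 1 - (1 - x) = x by lra.
move=> rho /(smallest_fixpointP hbeta hgamma _ mu1)[r01 hr]; split; first lra.
split=> [eps eps0|].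
  (* [eps] gives the required accuracy, [(1 - rho) / 3] the room needed for uniqueness. *)
  pose delta := Rmin eps ((1 - rho) / 3).
  have d0 : 0 < delta by apply: Rmin_glb_lt; lra.
  have d1 : delta <= eps by apply: Rmin_l.
  have d2 : delta <= (1 - rho) / 3 by apply: Rmin_r.
  have d3 : 3 * delta <= 1 - rho by lra.
  have [K [C whp]] := giant_whp hbeta hgamma r01 hr d0 d3.
  apply: (@Un_cv_of_rate _ C); apply: eventually_mono whp => n; apply=> B _ big.
  by apply/RlebP; move: big; rewrite /giant_size; lra.
have d0 : 0 < (1 - rho) / 3 by lra.
have d3 : 3 * ((1 - rho) / 3) <= 1 - rho by lra.
have [K [C whp]] := giant_whp hbeta hgamma r01 hr d0 d3.
exists K; apply: (@Un_cv_of_rate _ C); apply: eventually_mono whp => n; apply=> B [v _ vw] _.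
apply/existsP; exists v; apply/forallP => w; apply/implyP => h.
by apply/RlebP; apply: vw.
Qed.
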